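(* The maps $f^*:\mathcal{P}\to\mathrm{Qsym}[t_1,t_2,\dots][\alpha]$ and $F:\mathcal{R}\to\mathrm{Qsym}[t_1,t_2,\dots]$ are compatible with the coactions: the equality $$\Delta\circ f^*=(f^*\otimes F)\circ\Delta$$ of maps $\mathcal{P}\to\mathrm{Qsym}[t_1,t_2,\dots][\alpha]\otimes\mathrm{Qsym}[t_1,t_2,\dots]$ holds, where on the right $\Delta:\mathcal{P}\to\mathcal{P}\otimes\mathcal{R}$ and on the left $\Delta:\mathrm{Qsym}[t_1,t_2,\dots][\alpha]\to\mathrm{Qsym}[t_1,t_2,\dots][\alpha]\otimes\mathrm{Qsym}[t_1,t_2,\dots]$.
   Context: A combinatorial polytope is a combinatorial equivalence class of convex polytopes; $\mathcal{P}$ is the ring of polytopes: the free abelian group on (non-empty) combinatorial polytopes with multiplication the direct product and unit the point. A finite poset with minimal element $\hat0$ and maximal element $\hat1$ is graded if it has a rank function $\rho$ with $\rho(\hat0)=0$ and $\rho(y)=\rho(x)+1$ whenever $y$ covers $x$; write $\rho(x,y)=\rho(y)-\rho(x)$. $\mathcal{R}$ is the Rota–Hopf algebra (over $\mathbb{Z}$): the free module on isomorphism classes of finite graded posets with multiplication the cartesian product and unit the one-element poset. The map $\Delta:\mathcal{P}\to\mathcal{P}\otimes\mathcal{R}$ is the linear map $\Delta(P)=\sum_{F\subseteq P}F\otimes[F,P]$, the sum over all non-empty faces $F$ of $P$ (including $P$), where $[F,P]$ is the interval in the face lattice of $P$. For a composition $\omega=(j_1,\dots,j_k)$, $j_i\ge1$,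 $M_\omega=\sum_{l_1<\dots<l_k}t_{l_1}^{j_1}\cdots t_{l_k}^{j_k}$; $\mathrm{Qsym}[t_1,t_2,\dots]$ is the ring of finite integer combinations of the $M_\omega$ (and constants, $M_{\varnothing}=1$). The comultiplication is $\Delta M_{(b_1,\dots,b_k)}=\sum_{i=0}^{k}M_{(b_1,\dots,b_i)}\otimes M_{(b_{i+1},\dots,b_k)}$, extended to $\mathrm{Qsym}[t_1,t_2,\dots][\alpha]$ by $\Delta(\alpha^aM_{(b_1,\dots,b_k)})=\sum_{i=0}^{k}\alpha^aM_{(b_1,\dots,b_i)}\otimes M_{(b_{i+1},\dots,b_k)}$. The Ehrenborg quasi-symmetric function is the linear map $F:\mathcal{R}\to\mathrm{Qsym}[t_1,t_2,\dots]$, $F(P)=\sum_{\hat0=x_0<x_1<\dots<x_{k+1}=\hat1}M_{(\rho(x_0,x_1),\dots,\rho(x_k,x_{k+1}))}$ (sum over all chains from $\hat0$ to $\hat1$; $F=1$ on the one-element poset). The involution $*$ is $\mathbb{Z}[\alpha]$-linear with $M_{(j_1,\dots,j_k)}^*=M_{(j_k,\dots,j_1)}$, and $f^*(P)=f(P)^*$, where the generalized $f$-polynomial is $$f(P^n)=\alpha^n+\sum_{k=1}^{n}\ \sum_{0\leqslant a_1<\dots<a_k\leqslant n-1}f_{a_1,\dots,a_k}\,\alpha^{a_1}M_{(n-a_k,\,a_k-a_{k-1},\dots,\,a_2-a_1)},$$ with $f_{a_1,\dots,a_k}$ the number of chains of faces $F^{a_1}\subset\dots\subset F^{a_k}$ of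 $P^n$, $\dim F^{a_i}=a_i$. *)

(* Defs.v *)
From HB Require Import structures.
From mathcomp Require Import all_boot all_order all_algebra.
From mathcomp Require Import finmap.
From mathcomp Require Import freeg.
From mathcomp Require Import all_classical reals.

Set Implicit Arguments.
Unset Strict Implicit.
Unset Printing Implicit Defensive.
Import Order.TTheory GRing.Theory Num.Theory.
Local Open Scope ring_scope.
Local Open Scope quotient_scope.

Section ZLift.
Variables (K : choiceType) (V : zmodType) (f : K -> V).

Definition zlift (D : {freeg K / int}) : V := @fglift int (zmodule V) K f D.

Lemma zliftU (x : K) : zlift << x >> = f x.
Proof. by rewrite /zlift liftU scale1r. Qed.

Fact zlift_is_zmod_morphism : zmod_morphism zlift.
Proof. exact: (@lift_is_additive int K (zmodule V) f). Qed.
HB.instance Definition _ :=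
  GRing.isZmodMorphism.Build {freeg K / int} V zlift zlift_is_zmod_morphism.

Lemma zliftE (D : {freeg K / int}) :
  zlift D = \sum_(x <- dom D) f x *~ coeff x D.
Proof.
rewrite -[D in LHS]freeg_sumE raddf_sum /=; apply: eq_bigr => x _.
by rewrite /zlift liftU.
Qed.
End ZLift.

(* Tensor product over int: the free abelian group on A * B modulo the
   subgroup generated by the biadditivity relations. *)
Section Tensor.
Variables A B : zmodType.
Local Notation fgAB := {freeg (A * B)%type / int}.

Definition biadd_gen (x : fgAB) : Prop :=
  (exists a a' b, x = << (a + a', b) >> - << (a, b) >> - << (a', b) >>) \/
  (exists a b b', x = << (a, b + b') >> - << (a, b) >> - << (a, b') >>).

Definition biadd_rel : {pred fgAB} :=
  [pred x | `[< forall S : zmodClosed fgAB,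
                 (forall y, biadd_gen y -> y \in S) -> x \in S >]].

Fact biadd_rel_closed : zmod_closed biadd_rel.
Proof.
split=> [|x y /asboolP hx /asboolP hy]; apply/asboolP => S hS.
  exact: rpred0.
by rewrite rpredB ?hx ?hy.
Qed.
HB.instance Definition _ :=
  GRing.isZmodClosed.Build fgAB biadd_rel biadd_rel_closed.

Definition tensor : Type := Quotient.quot biadd_rel.
HB.instance Definition _ := GRing.Zmodule.on tensor.

Definition pure (a : A) (b : B) : tensor :=
  \pi_(Quotient.quot biadd_rel) << (a, b) >>.

Lemma biadd_genP x : biadd_gen x -> \pi_(Quotient.quot biadd_rel) x = 0 :> tensor.
Proof.
move=> gx; have xR : x - 0 \in biadd_rel.
  by rewrite subr0; apply/asboolP => S; apply.
by move: xR; rewrite Quotient.idealrBE => /eqP ->; exact: raddf0.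
Qed.

Lemma pureDl a a' b : pure (a + a') b = pure a b + pure a' b.
Proof.
have /biadd_genP : biadd_gen (<< (a + a', b) >> - << (a, b) >> - << (a', b) >>).
  by left; exists a, a', b.
by rewrite !raddfB => /eqP; rewrite -addrA -opprD subr_eq0 => /eqP.
Qed.

Lemma pureDr a b b' : pure a (b + b') = pure a b + pure a b'.
Proof.
have /biadd_genP : biadd_gen (<< (a, b + b') >> - << (a, b) >> - << (a, b') >>).
  by right; exists a, b, b'.
by rewrite !raddfB => /eqP; rewrite -addrA -opprD subr_eq0 => /eqP.
Qed.

Section Lift.
Variables (C : zmodType) (h : A -> B -> C).

(* Meaningful for biadditive h, see [tliftE]. *)
Definition tlift (t : tensor) : C :=
  zlift (fun p => h p.1 p.2) (repr (t : Quotient.quot biadd_rel)).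

Hypothesis hDl : forall a a' b, h (a + a') b = h a b + h a' b.
Hypothesis hDr : forall a b b', h a (b + b') = h a b + h a b'.

Definition tker : {pred fgAB} := [pred x | zlift (fun p => h p.1 p.2) x == 0].
Fact tker_closed : zmod_closed tker.
Proof.
split=> [|x y /eqP hx /eqP hy]; apply/eqP; first exact: raddf0.
by rewrite (raddfB (zlift _)) /= hx hy subr0.
Qed.
HB.instance Definition _ := GRing.isZmodClosed.Build fgAB tker tker_closed.

Lemma tlift_pi (x : fgAB) :
  tlift (\pi_(Quotient.quot biadd_rel) x) = zlift (fun p => h p.1 p.2) x.
Proof.
rewrite /tlift; set y := repr _; have : y - x \in biadd_rel.
  by rewrite Quotient.idealrBE reprK.
move=> /asboolP /(_ tker) yx; apply/eqP; rewrite -subr_eq0 -raddfB.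
apply: yx => z [] [a [b [c ->]]]; apply/eqP; rewrite !(raddfB (zlift _)) /= !zliftU /=.
  by rewrite hDl -addrA -opprD subrr.
by rewrite hDr -addrA -opprD subrr.
Qed.

Lemma tliftE a b : tlift (pure a b) = h a b.
Proof. by rewrite tlift_pi zliftU. Qed.

Lemma tlift_zmod_morphism : zmod_morphism tlift.
Proof.
move=> x y; rewrite -[x]reprK -[y]reprK -raddfB.
by rewrite [LHS]tlift_pi raddfB /= -!tlift_pi.
Qed.
End Lift.
End Tensor.

Section TensorMap.
Variables (A B A' B' : zmodType).
Variables (f : {additive A -> A'}) (g : {additive B -> B'}).

Definition tmap : tensor A B -> tensor A' B' :=
  tlift (fun a b => pure (f a) (g b)).

Lemma tmapE a b : tmap (pure a b) = pure (f a) (g b).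
Proof.
by apply: tliftE => *; rewrite raddfD (pureDl, pureDr).
Qed.

Fact tmap_is_zmod_morphism : zmod_morphism tmap.
Proof.
by apply: tlift_zmod_morphism => *; rewrite raddfD (pureDl, pureDr).
Qed.
HB.instance Definition _ := GRing.isZmodMorphism.Build (tensor A B) (tensor A' B')
  tmap tmap_is_zmod_morphism.
End TensorMap.

(* The subgroup of V spanned by a family b. *)
Section Span.
Variables (I : choiceType) (V : zmodType) (b : I -> V).

Definition in_span : {pred V} :=
  [pred v | `[< exists c : {freeg I / int}, zlift b c = v >]].

Fact in_span_closed : zmod_closed in_span.
Proof.
split=> [|x y /asboolP[c <-] /asboolP[d <-]]; apply/asboolP.
  by exists 0; rewrite raddf0.
by exists (c - d); rewrite raddfB.
Qed.
HB.instance Definition _ := GRing.isZmodClosed.Build V in_span in_span_closed.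

Definition span := {v : V | v \in in_span}.
HB.instance Definition _ := SubChoice.on span.
HB.instance Definition _ := [SubChoice_isSubZmodule of span by <:].

Fact spanU_subproof i : b i \in in_span.
Proof. by apply/asboolP; exists << i >>; rewrite zliftU. Qed.
Definition spanU (i : I) : span := Sub (b i) (spanU_subproof i).

Definition span_coord (x : span) : {freeg I / int} := sval (cid (asboolP _ (valP x))).

Lemma span_coordK (x : span) : zlift b (span_coord x) = val x.
Proof. exact: svalP (cid (asboolP _ (valP x))). Qed.

(* Meaningful for a linearly independent family b, see [span_liftU]. *)
Definition span_lift (W : zmodType) (f : I -> W) (x : span) : W :=
  zlift f (span_coord x).

Hypothesis b_free : injective (zlift b).

Lemma span_coordU i : span_coord (spanU i) = << i >>.
Proof. by apply: b_free; rewrite span_coordK zliftU. Qed.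

Lemma span_liftU (W : zmodType) (f : I -> W) i : span_lift f (spanU i) = f i.
Proof. by rewrite /span_lift span_coordU zliftU. Qed.

Lemma span_lift_zmod_morphism (W : zmodType) (f : I -> W) :
  zmod_morphism (span_lift f).
Proof.
move=> x y; rewrite /span_lift -raddfB; congr zlift; apply: b_free.
by rewrite [RHS]raddfB /= !span_coordK; exact: raddfB.
Qed.
End Span.

Definition composition := {w : seq nat | all (leq 1) w}.
HB.instance Definition _ := Choice.on composition.

Local Notation mono := {fsfun nat -> nat with 0%N}.

Definition series := mono -> int.
HB.instance Definition _ := GRing.Zmodule.on series.
Definition aseries := nat * mono -> int.
HB.instance Definition _ := GRing.Zmodule.on aseries.

(* Formal power series in the variables t_0, t_1, ... are given by their
   coefficients.  In the sum of the t_(l_1)^(w_1) ... t_(l_k)^(w_k) over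
   l_1 < ... < l_k, a monomial m arises from at most one sequence l. *)
Definition Mseries (w : composition) : series := fun m =>
  (`[< exists l : seq nat, [/\ size l = size (val w), sorted ltn l &
        forall i, m i = \sum_(p <- zip l (val w) | p.1 == i) p.2] >] : nat)%:Z.

Definition aMseries (aw : nat * composition) : aseries := fun am =>
  if am.1 == aw.1 then Mseries aw.2 am.2 else 0.

Lemma zlift_eval (K : choiceType) (T : Type) (V : zmodType) (f : K -> T -> V)
    (D : {freeg K / int}) (t : T) : zlift f D t = zlift (f^~ t) D.
Proof.
rewrite !zliftE fct_sumE; apply: eq_bigr => x _.
have fMn (g : T -> V) n : (g *+ n) t = g t *+ n.
  by elim: n => // n IH; rewrite !mulrS -IH.
by case: (coeff x D) => n; rewrite /intmul -fMn.
Qed.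

Lemma zlift_delta (K : choiceType) (x : K) (D : {freeg K / int}) :
  zlift (fun y => (y == x)%:Z) D = coeff x D.
Proof.
rewrite zliftE -[D in RHS]freeg_sumE raddf_sum; apply: eq_bigr => y _ /=.
by rewrite coeffU mulrC -mulrzr intz; case: eqP.
Qed.

Definition mono_of (w : composition) : mono :=
  [fsfun i in [fset i in iota 0 (size (val w))]%fset => nth 0%N (val w) i].

Lemma mono_ofE w i : mono_of w i = nth 0%N (val w) i.
Proof.
rewrite fsfunE in_fset /= mem_iota add0n /=; case: ltnP => // le_i.
by rewrite nth_default.
Qed.

Lemma Mseries_mono_of (w w' : composition) :
  Mseries w (mono_of w') = (w == w')%:Z.
Proof.
rewrite /Mseries; congr (nat_of_bool _)%:Z; apply/asboolP/eqP => [[l [sl ltl lE]]|<-].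
  have pos (v : composition) i : (i < size (val v))%N -> (0 < nth 0%N (val v) i)%N.
    by move=> iv; exact: (allP (valP v)) (mem_nth _ iv).
  have lnth k : (k < size l)%N -> mono_of w' (nth 0%N l k) = nth 0%N (val w) k.
    move=> kl; rewrite lE (big_nth (0, 0)%N) size_zip sl minnn.
    have ul : uniq l by rewrite (sorted_uniq ltn_trans ltnn).
    rewrite big_mkord -sl (bigD1 (Ordinal kl)) /= ?nth_zip //= big1; first exact: addn0.
    move=> j /andP[]; rewrite nth_zip //= nth_uniq // => /eqP jk /negP[].
    exact/eqP/val_inj.
  have lE' : l = iota 0 (size (val w')).
    apply: (irr_sorted_eq ltn_trans ltnn) ltl (iota_ltn_sorted _ _) _ => i.
    rewrite mem_iota add0n /=; apply/idP/idP => [/(nthP 0%N)[k kl <-]|iw].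
      have := pos w k; rewrite -sl -lnth // mono_ofE => /(_ kl).
      by case: (ltnP (nth 0%N l k) (size (val w'))) => // ?; rewrite nth_default.
    apply: contraLR (pos w' i iw) => il; rewrite -leqNgt -mono_ofE lE big1_seq //.
    move=> [p q] /=/andP[/eqP -> ]; move=> /(map_f fst) /=.
    by rewrite -/(unzip1 _) unzip1_zip ?sl // (negbTE il).
  have sw : size (val w) = size (val w') by rewrite -sl lE' size_iota.
  apply/val_inj/(eq_from_nth (x0 := 0%N) sw) => i iw.
  by rewrite -lnth ?sl // lE' nth_iota -?sw // add0n mono_ofE.
exists (iota 0 (size (val w))); split; [exact: size_iota|exact: iota_ltn_sorted|].
move=> i; rewrite mono_ofE (big_nth (0, 0)%N) size_zip size_iota minnn big_mkord.
under eq_bigl => k do rewrite nth_zip ?size_iota //= nth_iota // add0n.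
under eq_bigr => k _ do rewrite nth_zip ?size_iota //=.
case: (ltnP i (size (val w))) => iw.
  rewrite (bigD1 (Ordinal iw)) //= big1; first exact/esym/addn0.
  move=> k /andP[/eqP ki /negP[]].
  exact/eqP/val_inj.
rewrite nth_default // big1 // => k /eqP ki.
by have := ltn_ord k; rewrite ki ltnNge iw.
Qed.

Lemma Mseries_free : injective (zlift Mseries).
Proof.
move=> c d cd; apply/eqP/freeg_eqP => w; rewrite -!zlift_delta.
have E y : (y == w)%:Z = Mseries y (mono_of w) by rewrite Mseries_mono_of.
by rewrite (funext E) -!zlift_eval cd.
Qed.

Lemma aMseries_free : injective (zlift aMseries).
Proof.
move=> c d cd; apply/eqP/freeg_eqP => -[a w]; rewrite -!zlift_delta.
have E y : (y == (a, w))%:Z = aMseries y (a, mono_of w).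
  case: y => a' w'; rewrite /aMseries /= xpair_eqE eq_sym.
  by case: eqP => //=; rewrite Mseries_mono_of.
by rewrite (funext E) -!zlift_eval cd.
Qed.

(* Qsym[t_1, t_2, ...] and Qsym[t_1, t_2, ...][alpha], as additive groups. *)
Definition qsym : Type := span Mseries.
HB.instance Definition _ := GRing.Zmodule.on qsym.
Definition qsymA : Type := span aMseries.
HB.instance Definition _ := GRing.Zmodule.on qsymA.

(* M_w and alpha^a M_w, for w a list of positive integers (the default value
   of [insubd] is never used on such lists). *)
Definition comp_of (w : seq nat) : composition := insubd (Sub [::] isT : composition) w.
Definition M (w : seq nat) : qsym := spanU Mseries (comp_of w).
Definition alphaM (a : nat) (w : seq nat) : qsymA := spanU aMseries (a, comp_of w).

(* The additive map on Qsym[alpha] with prescribed values on the basis. *)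
Definition qsymA_lift (W : zmodType) (f : nat -> seq nat -> W) : qsymA -> W :=
  @span_lift _ _ aMseries W (fun aw => f aw.1 (val aw.2)).
Fact qsymA_lift_zmod_morphism (W : zmodType) (f : nat -> seq nat -> W) :
  zmod_morphism (qsymA_lift f).
Proof. exact: span_lift_zmod_morphism aMseries_free _ _. Qed.
HB.instance Definition _ (W : zmodType) (f : nat -> seq nat -> W) :=
  GRing.isZmodMorphism.Build qsymA W (qsymA_lift f) (qsymA_lift_zmod_morphism f).

Lemma qsymA_liftE (W : zmodType) (f : nat -> seq nat -> W) a (w : composition) :
  qsymA_lift f (alphaM a (val w)) = f a (val w).
Proof. rewrite /alphaM /comp_of valKd.
exact: (span_liftU aMseries_free (fun aw => f aw.1 (val aw.2))). Qed.

Definition star : {additive qsymA -> qsymA} :=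
  qsymA_lift (fun a w => alphaM a (rev w)).

Definition qsymA_Delta : {additive qsymA -> tensor qsymA qsym} :=
  qsymA_lift (fun a w =>
    \sum_(i < (size w).+1) pure (alphaM a (take i w)) (M (drop i w))).

Definition covers (T : finType) (le : rel T) (x y : T) : bool :=
  [&& le x y, x != y & [forall z, le x z && le z y ==> (z == x) || (z == y)]].

Record graded_poset (T : finType) (le : rel T) (bot top : T) (rho : T -> nat) :
    Prop := GradedPoset {
  gp_refl : reflexive le;
  gp_anti : antisymmetric le;
  gp_trans : transitive le;
  gp_bot : forall x, le bot x;
  gp_top : forall x, le x top;
  gp_rho0 : rho bot = 0%N;
  gp_rhoS : forall x y, covers le x y -> rho y = (rho x).+1 }.

(* Carriers are restricted to the types 'I_n, so that finite graded posets
   form a small type; every finite graded poset is isomorphic to one of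
   these, see [gposet_of]. *)
Record gposet := GPoset {
  gcard : nat;
  gle : rel 'I_gcard;
  gbot : 'I_gcard;
  gtop : 'I_gcard;
  grank : 'I_gcard -> nat;
  gposetP : graded_poset gle gbot gtop grank }.
HB.instance Definition _ := gen_eqMixin gposet.
HB.instance Definition _ := gen_choiceMixin gposet.

Section GposetOf.
Variables (T : finType) (le : rel T) (bot top : T) (rho : T -> nat).
Hypothesis H : graded_poset le bot top rho.

Fact gposet_of_subproof :
  graded_poset (fun i j : 'I_#|T| => le (enum_val i) (enum_val j))
    (enum_rank bot) (enum_rank top) (fun i => rho (enum_val i)).
Proof.
case: H => r a t b u r0 rS; split.
- by move=> i; exact: r.
- by move=> i j /a; exact: enum_val_inj.
- by move=> i j k; exact: t.
- by move=> i; rewrite enum_rankK.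
- by move=> i; rewrite enum_rankK.
- by rewrite enum_rankK.
- move=> i j /and3P[ij nij /forallP h]; apply: rS; apply/and3P; split=> //.
    by apply: contra_neq nij => /enum_val_inj.
  apply/forallP => z; have := h (enum_rank z); rewrite enum_rankK.
  by rewrite -!(inj_eq enum_val_inj) enum_rankK.
Qed.

Definition gposet_of : gposet := GPoset gposet_of_subproof.
End GposetOf.

Definition giso (P Q : gposet) : Prop :=
  exists2 f : 'I_(gcard P) -> 'I_(gcard Q),
    bijective f & forall x y, gle (f x) (f y) = gle x y.

Fact giso_equiv : equiv_class_of (fun P Q => `[< giso P Q >]).
Proof.
split.
- by move=> P; apply/asboolP; exists id => //; exists id.
- suff sym P Q : giso P Q -> giso Q P.
    by move=> P Q; apply/asboolP/asboolP; exact: sym.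
  move=> [f [g fg gf] h]; exists g; first by exists f.
  by move=> x y; rewrite -h !gf.
- move=> Q P S /asboolP[f bf hf] /asboolP[g bg hg]; apply/asboolP.
  exists (g \o f); first exact: bij_comp.
  by move=> x y; rewrite /= hg hf.
Qed.
Canonical giso_equivRel := EquivRelPack giso_equiv.

(* Values on a class are computed on the representative chosen by [repr]; the
   constructions below depend on the isomorphism class only. *)
Definition gclass : Type := {eq_quot giso_equivRel}.
HB.instance Definition _ := Choice.on gclass.
Definition gclass_of (P : gposet) : gclass := \pi_{eq_quot giso_equivRel} P.
Definition gclass_repr (c : gclass) : gposet := repr (c : {eq_quot giso_equivRel}).

(* The Rota-Hopf algebra, as an additive group. *)
Definition rota : Type := {freeg gclass / int}.
HB.instance Definition _ := GRing.Zmodule.on rota.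

(* A chain x_0 < x_1 < ... < x_k from the bottom to the top element is
   represented by the tuple (x_1, ..., x_k); k = 0 occurs for the one-element
   poset only, in which case the sum is M_[::], i.e. 1. *)
Definition ehrenborg_rep (P : gposet) : qsym :=
  \sum_(k < gcard P) \sum_(c : k.-tuple 'I_(gcard P) |
      path (fun x y => gle x y && (x != y)) (gbot P) c &&
      (last (gbot P) c == gtop P))
    M (pairmap (fun x y => grank y - grank x)%N (gbot P) c).

Definition ehrenborg : {additive rota -> qsym} :=
  zlift (fun c => ehrenborg_rep (gclass_repr c)).

Local Open Scope classical_set_scope.

Section Polytopes.
Variable R : realType.

Definition dot n (x : 'rV[R]_n) (c : 'cV[R]_n) : R := (x *m c) 0 0.

Definition conv n (s : seq 'rV[R]_n) : set 'rV[R]_n :=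
  [set x | exists w : 'rV[R]_n -> R,
    [/\ forall v, 0 <= w v, \sum_(v <- s) w v = 1 & x = \sum_(v <- s) w v *: v]].

Record polytope := Polytope {
  pamb : nat;
  pset :> set 'rV[R]_pamb;
  polytopeP : exists2 s, s != [::] & pset = conv s }.
HB.instance Definition _ := gen_eqMixin polytope.
HB.instance Definition _ := gen_choiceMixin polytope.

(* c = 0 gives the improper faces, P (b = 0) and set0 (b = 1). *)
Definition is_face n (P F : set 'rV[R]_n) : Prop :=
  exists (c : 'cV[R]_n) (b : R),
    (forall x, P x -> dot x c <= b) /\ F = P `&` [set x | dot x c = b].

(* Dimension of the affine hull of a non-empty set S: the greatest k such that
   S contains k + 1 affinely independent points. *)
Definition affdim n (S : set 'rV[R]_n) : nat :=
  \max_(k < n.+1 | `[< exists (x0 : 'rV[R]_n) (A : 'M[R]_(k, n)),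
      [/\ S x0, forall i, S (x0 + row i A) & row_free A] >]) k.

Lemma dotD n (x y : 'rV[R]_n) c : dot (x + y) c = dot x c + dot y c.
Proof. by rewrite /dot mulmxDl mxE. Qed.
Lemma dotN n (x : 'rV[R]_n) c : dot (- x) c = - dot x c.
Proof. by rewrite /dot mulNmx mxE. Qed.
Lemma dotB n (x y : 'rV[R]_n) c : dot (x - y) c = dot x c - dot y c.
Proof. by rewrite dotD dotN. Qed.
Lemma dotZ n a (x : 'rV[R]_n) c : dot (a *: x) c = a * dot x c.
Proof. by rewrite /dot -scalemxAl mxE. Qed.
Lemma dotDr n (x : 'rV[R]_n) c d : dot x (c + d) = dot x c + dot x d.
Proof. by rewrite /dot mulmxDr mxE. Qed.
Lemma dotZr n a (x : 'rV[R]_n) c : dot x (a *: c) = a * dot x c.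
Proof. by rewrite /dot -scalemxAr mxE. Qed.
Lemma dot_sum n (s : seq 'rV[R]_n) (w : 'rV[R]_n -> R) c :
  dot (\sum_(v <- s) w v *: v) c = \sum_(v <- s) w v * dot v c.
Proof.
rewrite /dot mulmx_suml summxE; apply: eq_bigr => v _.
by rewrite -scalemxAl mxE.
Qed.

Lemma conv_ge0 n (s : seq 'rV[R]_n) c b x :
  (forall v, v \in s -> dot v c <= b) -> conv s x -> dot x c <= b.
Proof.
move=> sb [w [w0 w1 ->]]; rewrite dot_sum -[leRHS]mul1r -w1 mulr_suml.
by rewrite big_seq [leRHS]big_seq; apply: ler_sum => v vs; rewrite ler_wpM2l ?sb.
Qed.

Lemma conv_mem n (s : seq 'rV[R]_n) v : v \in s -> conv s v.
Proof.
move=> vs; pose m := (count_mem v s)%:R : R.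
have m0 : m != 0 by rewrite pnatr_eq0 -lt0n -has_count has_pred1.
have E : \sum_(u <- s) (u == v)%:R = m.
  by rewrite /m; elim: (s) => [|u t IH]; rewrite ?big_nil // big_cons IH natrD.
exists (fun u => (u == v)%:R / m); split.
- by move=> u; rewrite divr_ge0 ?ler0n.
- by rewrite -mulr_suml E divff.
- transitivity (\sum_(u <- s) ((u == v)%:R / m) *: v).
    by rewrite -scaler_suml -mulr_suml E divff // scale1r.
  by apply: eq_bigr => u _; case: eqP => [->|] //; rewrite mul0r !scale0r.
Qed.

Lemma conv_face n (s : seq 'rV[R]_n) c b :
  (forall v, v \in s -> dot v c <= b) ->
  conv s `&` [set x | dot x c = b] = conv [seq v <- s | dot v c == b].
Proof.
move=> sb; apply/seteqP; split=> [x [[w [w0 w1 xE]] xb]|x [w [w0 w1 xE]]].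
  have E : \sum_(v <- s | v \in s) w v * (b - dot v c) = 0.
    rewrite -big_seq; under eq_bigr do rewrite mulrBr.
    by rewrite sumrB -mulr_suml w1 mul1r -dot_sum -xE xb subrr.
  have wz v : v \in s -> w v * (b - dot v c) = 0.
    move=> vs; move/eqP: E; rewrite psumr_eq0; last first.
      by move=> u us; rewrite mulr_ge0 // subr_ge0 sb.
    by move=> /allP/(_ v vs)/implyP/(_ vs)/eqP.
  have wE v : v \in s -> dot v c != b -> w v = 0.
    move=> /wz/eqP; rewrite mulf_eq0 subr_eq0 => /orP[/eqP //|/eqP ->].
    by rewrite eqxx.
  exists w; split=> //; rewrite big_filter big_mkcond /=.
    rewrite -w1 big_seq [RHS]big_seq; apply: eq_bigr => v vs.
    by case: eqP => // /eqP/(wE v vs).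
  rewrite xE big_seq [RHS]big_seq; apply: eq_bigr => v vs.
  by case: eqP => // /eqP/(wE v vs) ->; rewrite scale0r.
rewrite big_filter in w1; rewrite big_filter in xE; split.
  exists (fun v => if dot v c == b then w v else 0); split.
  - by move=> v; case: ifP.
  - by rewrite -w1 [RHS]big_mkcond.
  - by rewrite xE [LHS]big_mkcond; apply: eq_bigr => v _; case: eqP; rewrite ?scale0r.
rewrite /= xE -big_filter dot_sum big_filter -[RHS]mul1r -w1 mulr_suml.
by apply: eq_bigr => v /eqP ->.
Qed.

Lemma conv_nil n x : ~ conv ([::] : seq 'rV[R]_n) x.
Proof. by case=> w [_]; rewrite big_nil => /eqP; rewrite eq_sym oner_eq0. Qed.

Lemma conv_faceP n (s : seq 'rV[R]_n) (F : set 'rV[R]_n) :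
  is_face (conv s) F <->
  exists c b, (forall v, v \in s -> dot v c <= b) /\
              F = conv [seq v <- s | dot v c == b].
Proof.
split=> -[c [b [h ->]]]; exists c, b; split.
- by move=> v /conv_mem/h.
- by rewrite conv_face // => v /conv_mem/h.
- by move=> x; exact: conv_ge0.
- by rewrite conv_face.
Qed.

Lemma finite_faces (P : polytope) : finite_set [set F | is_face P F].
Proof.
have [s _ ->] := polytopeP P.
pose g (m : (size s).-tuple bool) := conv (mask m s).
apply: (@sub_finite_set _ _ (g @` setT)); last first.
  by apply: finite_image; exact: finite_finset.
move=> F /conv_faceP[c [b [_ ->]]] /=.
by exists [tuple of map (fun v => dot v c == b) (in_tuple s)]; rewrite // filter_mask.
Qed.

Lemma face_polytope_subproof (P : polytope) F :
  is_face P F -> F != set0 -> exists2 s, s != [::] & F = conv s.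
Proof.
have [s _ ->] := polytopeP P => /conv_faceP[c [b [_ ->]]] F0.
eexists; last reflexivity; apply: contra_neq F0 => ->.
by apply/seteqP; split=> // x /conv_nil.
Qed.

(* The face lattice of P, including the empty face. *)
Definition faces (P : polytope) : {fset set 'rV[R]_(pamb P)} :=
  fset_set [set F | is_face P F].

Lemma facesP (P : polytope) F : F \in faces P <-> is_face P F.
Proof. by rewrite in_fset_set ?inE //; exact: finite_faces. Qed.

Definition face (P : polytope) : finType := faces P.
Definition fle (P : polytope) : rel (face P) := fun F G => `[< val F `<=` val G >].
Definition nonempty_face (P : polytope) : finType := {F : face P | val F != set0}.

Definition face_polytope (P : polytope) (F : nonempty_face P) : polytope :=
  @Polytope (pamb P) (val (val F))
    (face_polytope_subproof (iffLR (@facesP P _) (valP (val F))) (valP F)).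

(* Face lattices are graded by dimension. *)

Lemma affdim_ge n (S : set 'rV[R]_n) k x0 (A : 'M[R]_(k, n)) :
  S x0 -> (forall i, S (x0 + row i A)) -> row_free A -> (k <= affdim S)%N.
Proof.
move=> Sx SA fA; have kn : (k < n.+1)%N by rewrite ltnS -(eqP fA) rank_leq_col.
rewrite /affdim; apply: (@leq_bigmax_cond _ _ (fun i : 'I_n.+1 => i : nat) (Ordinal kn)).
by apply/asboolP; exists x0, A.
Qed.

Lemma row_free_add n k (A : 'M[R]_(k, n)) (u : 'rV[R]_n) :
  row_free A -> ~~ (u <= A)%MS -> row_free (col_mx A u).
Proof.
move=> fA uA; have u0 : u != 0 by apply: contraNneq uA => ->; exact: sub0mx.
have cap0 : (A :&: u)%MS = 0.
  apply/eqP; rewrite -mxrank_eq0; have := mxrankS (capmxSr A u).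
  rewrite leq_eqVlt rank_rV u0 ltnS leqn0 => /orP[/eqP r|//].
  case/negP: uA; have [_ +] := mxrank_leqif_sup (capmxSr A u).
  rewrite rank_rV u0 r eqxx => /esym h; exact: submx_trans h (capmxSl A u).
have := mxrank_sum_cap A u; rewrite cap0 mxrank0 addn0 (eqP fA) rank_rV u0.
by rewrite /row_free -addsmxE => ->.
Qed.

Lemma affdim_basis n (S : set 'rV[R]_n) : S !=set0 ->
  exists (x0 : 'rV[R]_n) (A : 'M[R]_(affdim S, n)),
    [/\ S x0, forall i, S (x0 + row i A), row_free A &
        forall x, S x -> (x - x0 <= A)%MS].
Proof.
move=> [y Sy]; pose p (k : 'I_n.+1) := `[< exists (x0 : 'rV[R]_n) (A : 'M[R]_(k, n)),
      [/\ S x0, forall i, S (x0 + row i A) & row_free A] >].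
have p0 : p ord0.
  apply/asboolP; exists y, 0; split=> //; first by case.
  by rewrite /row_free mxrank0.
have [k /asboolP[x0 [A [Sx SA fA]]] kE] : {k : 'I_n.+1 | p k & affdim S = k}.
  exact: (eq_bigmax_cond (fun k : 'I_n.+1 => k : nat)) (introT card_gt0P (ex_intro _ ord0 p0)).
rewrite kE; exists x0, A; split=> // x Sx'; apply/negPn/negP => /(row_free_add fA) fA'.
suff : (k + 1 <= affdim S)%N by rewrite kE addn1 ltnn.
apply: affdim_ge Sx _ fA' => i; case: (split_ordP i) => j ->.
  by rewrite rowKu.
by rewrite rowKd row_id // addrCA subrr addr0.
Qed.

Lemma affdimS n (S T : set 'rV[R]_n) : S !=set0 -> S `<=` T -> (affdim S <= affdim T)%N.
Proof.
move=> /affdim_basis[x0 [A [Sx SA fA _]]] ST.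
by apply: affdim_ge fA; [exact: ST Sx | move=> i; exact/ST/SA].
Qed.

Lemma face_dim_lt n (P F G : set 'rV[R]_n) : is_face P F -> is_face P G ->
  F !=set0 -> F `<=` G -> F != G -> (affdim F < affdim G)%N.
Proof.
move=> [c [b [Pb FE]]] [c' [b' [_ GE]]] F0 FG nFG.
have [y Gy nFy] : exists2 y, G y & ~ F y.
  apply: contrapT => h; case/eqP: nFG; apply/seteqP; split=> // y Gy.
  by apply: contrapT => nFy; apply: h; exists y.
have [x0 [A [Fx FA fA _]]] := affdim_basis F0.
have Fdot x : F x -> dot x c = b by rewrite FE => -[].
have Py : P y by move: Gy; rewrite GE => -[].
have Ac : A *m c = 0.
  apply/row_matrixP => i; rewrite row0 row_mul; apply/matrixP => j l.
  rewrite !ord1 [RHS]mxE -[LHS]/(dot (row i A) c).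
  by have := Fdot _ (FA i); rewrite dotD Fdot // => /(canRL (addKr _)) ->; rewrite addNr.
rewrite -addn1; apply: (@affdim_ge _ _ _ x0 (col_mx A (y - x0))).
- exact: FG.
- move=> i; case: (split_ordP i) => j ->; first by rewrite rowKu; exact/FG/FA.
  by rewrite rowKd row_id // addrCA subrr addr0.
- apply: row_free_add => //; apply/negP => /submxP[D yE].
  have : dot (y - x0) c = 0 by rewrite /dot yE -mulmxA Ac mulmx0 mxE.
  rewrite dotB (Fdot x0) // => /eqP; rewrite subr_eq0 => /eqP yb.
  by apply: nFy; rewrite FE.
Qed.

Lemma seq_max (T : eqType) (s : seq T) (f : T -> R) : s != [::] ->
  exists2 v, v \in s & forall u, u \in s -> f u <= f v.
Proof.
elim: s => // a [_ _|b s IH _].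
  by exists a; rewrite ?inE // => u; rewrite inE => /eqP ->.
have [v vs h] := IH isT; have [av|va] := leP (f a) (f v).
  exists v => [|u]; first by rewrite in_cons vs orbT.
  by rewrite in_cons => /orP[/eqP -> //|/h].
exists a => [|u]; first exact: mem_head.
rewrite in_cons => /orP[/eqP -> //|/h] /le_trans.
by apply; exact: ltW.
Qed.

(* A face of a face is a face: c, b cut out a face G, and q, e a face of G. *)
Lemma face_face n (s : seq 'rV[R]_n) (c q : 'cV[R]_n) (b e : R) :
  (forall v, v \in s -> dot v c <= b) ->
  (forall v, v \in s -> dot v c = b -> dot v q <= e) ->
  is_face (conv s) (conv s `&` [set x | dot x c = b] `&` [set x | dot x q = e]).
Proof.
move=> sb se.
have [N Nq] : exists N, forall v, v \in s -> dot v c != b ->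
    dot v q - e < N * (b - dot v c).
  elim: s sb {se} => [|a s IH] sb; first by exists 0.
  have [v vs|N NP] := IH; first by rewrite sb // inE vs orbT.
  exists (Num.max N ((dot a q - e) / (b - dot a c) + 1)) => v.
  rewrite inE => vas vb.
  have v0 : 0 < b - dot v c by rewrite subr_gt0 lt_neqAle vb sb // inE.
  rewrite -ltr_pdivrMr // lt_max; case/orP: vas => [/eqP <-|vs].
    by rewrite ltrDl ltr01 orbT.
  by rewrite ltr_pdivrMr // NP.
apply/conv_faceP; exists (N *: c + q), (N * b + e).
have E v : dot v (N *: c + q) - (N * b + e) = dot v q - e - N * (b - dot v c).
  by rewrite dotDr dotZr mulrBr opprD opprB addrACA addrC addrAC -!addrA.
split=> [v vs|].
  rewrite -subr_le0 E subr_le0; have [vb|vb] := eqVneq (dot v c) b.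
    by rewrite vb subrr mulr0 subr_le0 se.
  exact/ltW/Nq.
rewrite conv_face // conv_face => [|v]; last first.
  by rewrite mem_filter => /andP[/eqP vb vs]; exact: se.
rewrite -filter_predI; congr conv; apply: eq_in_filter => v vs /=.
rewrite -[RHS]subr_eq0 E; have [vb|vb] := eqVneq (dot v c) b.
  by rewrite vb subrr mulr0 subr0 subr_eq0 andbT.
by rewrite andbF subr_eq0 lt_eqF ?Nq.
Qed.

Lemma face_between n (s : seq 'rV[R]_n) F G :
  is_face (conv s) F -> is_face (conv s) G -> F !=set0 -> F `<=` G ->
  ((affdim F).+1 < affdim G)%N ->
  exists H, [/\ is_face (conv s) H, F `<=` H, H `<=` G, H != F & H != G].
Proof.
move=> [cF [bF [PF FE]]] [cG [bG [PG GE]]] F0 FG ltFG.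
have [x1 [A [Fx1 FA fA FsA]]] := affdim_basis F0.
have Fdot x : F x -> dot x cF = bF by rewrite FE => -[].
have nFG : F != G by apply: contraTneq ltFG => ->; rewrite -leqNgt leqnSn.
have [z Gz nFz] : exists2 z, G z & ~ F z.
  apply: contrapT => h; case/eqP: nFG; apply/seteqP; split=> // y Gy.
  by apply: contrapT => nFy; apply: h; exists y.
pose A' := col_mx A (z - x1).
have [y Gy yA] : exists2 y, G y & ~~ (y - x1 <= A')%MS.
  apply: contrapT => h; have GA y : G y -> (y - x1 <= A')%MS.
    by move=> Gy; apply/negPn/negP => yA; apply: h; exists y.
  have [x2 [B [Gx2 GB fB _]]] := affdim_basis (subset_nonempty FG F0).
  have : (B <= A')%MS.
    apply/row_subP => i; have := GA _ (GB i); have := GA _ Gx2 => h2 hB.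
    have -> : row i B = (x2 + row i B - x1) - (x2 - x1).
      by rewrite opprB addrA subrK addrC addKr.
    by rewrite addmx_sub // eqmx_opp.
  move=> /mxrankS; rewrite (eqP fB) leqNgt => /negP[].
  by rewrite (leq_ltn_trans (rank_leq_row _)) // addn1.
have [j yj] : exists j, ((y - x1) *m cokermx A') 0 j != 0.
  apply: contrapT => h; case/negP: yA; rewrite submxE; apply/eqP/matrixP => i j; rewrite !ord1 [RHS]mxE.
  by apply/eqP/negPn/negP => yj; apply: h; exists j.
pose d0 := col j (cokermx A').
have Ad0 : A' *m d0 = 0 by rewrite /d0 colE mulmxA mulmx_coker mul0mx.
have yd0 : dot (y - x1) d0 != 0 by rewrite /dot /d0 colE mulmxA -colE mxE.
pose d := dot (y - x1) d0 *: d0.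
have yd : dot (y - x1) d > 0 by rewrite dotZr -expr2 exprn_even_gt0.
have Ad : A' *m d = 0 by rewrite -scalemxAr Ad0 scaler0.
have subd u : (u <= A')%MS -> dot u d = 0.
  by move=> /submxP[D ->]; rewrite /dot -mulmxA Ad mulmx0 mxE.
have zd : dot (z - x1) d = 0 by rewrite subd // -addsmxE addsmxSr.
have Fd x : F x -> dot (x - x1) d = 0.
  by move=> /FsA h; rewrite subd // -addsmxE (submx_trans h) ?addsmxSl.
pose h x := bF - dot x cF.
have FconvG x : G x -> h x = 0 -> F x.
  rewrite GE => -[Px _] /eqP; rewrite subr_eq0 eq_sym => /eqP hx.
  by rewrite FE.
have GP x : G x -> conv s x by rewrite GE => -[].
have h0 x : G x -> 0 <= h x by move=> /GP/PF; rewrite subr_ge0.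
have hgt x : G x -> ~ F x -> 0 < h x.
  move=> Gx nFx; rewrite lt_neqAle h0 // andbT eq_sym; apply/eqP => hx.
  exact/nFx/FconvG.
have Fh x : F x -> h x = 0 by move=> /Fdot xb; rewrite /h xb subrr.
have sG : G = conv [seq v <- s | dot v cG == bG].
  by rewrite GE conv_face // => v /conv_mem/PG.
pose s' := [seq v <- s | (dot v cG == bG) && (h v != 0)].
have s'P v : v \in s' -> G v /\ 0 < h v.
  rewrite mem_filter => /andP[/andP[vG hv] vs].
  have Gv : G v by rewrite sG; apply: conv_mem; rewrite mem_filter vG.
  by split=> //; rewrite lt_neqAle eq_sym hv h0.
have s'0 : s' != [::].
  apply: contra_notN nFz => /eqP s'0; apply: FconvG => //.
  have hz : dot z cF = bF.
    move: Gz; rewrite sG => -[w [_ w1 ->]]; rewrite dot_sum -[RHS]mul1r -w1 mulr_suml.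
    rewrite big_seq [RHS]big_seq; apply: eq_bigr => v; rewrite mem_filter => /andP[vG vs].
    congr (_ * _); apply/eqP; rewrite eq_sym -subr_eq0 -/(h v); apply/negPn/negP => hv.
    by have : v \in s' by [rewrite mem_filter vG hv vs]; rewrite s'0.
  by rewrite /h hz subrr.
have [v0 v0s' v0max] := seq_max (fun v => dot (v - x1) d / h v) s'0.
have [Gv0 hv0] := s'P _ v0s'.
pose t := dot (v0 - x1) d / h v0.
pose q := t *: cF + d; pose e := t * bF + dot x1 d.
have qE x : dot x q - e = dot (x - x1) d - t * h x.
  by rewrite /q /e dotDr dotZr dotB /h mulrBr opprD opprB addrACA addrC addrAC -!addrA.
have qv v : v \in s -> dot v cG = bG -> dot v q <= e.
  move=> vs vG; have Gv : G v by rewrite GE; split=> //; exact: conv_mem.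
  rewrite -subr_le0 qE subr_le0; have [hv|hv] := eqVneq (h v) 0.
    by rewrite hv mulr0 Fd //; exact: FconvG.
  have vs' : v \in s' by rewrite mem_filter vG eqxx hv.
  by have [_ hv0'] := s'P _ vs'; rewrite -ler_pdivrMr // v0max.
have Gq x : G x -> dot x q <= e.
  rewrite sG; apply: conv_ge0 => v; rewrite mem_filter => /andP[/eqP vG vs]; exact: qv.
have t0 : 0 < t.
  have hy : 0 < h y.
    apply: hgt => // Fy; case/negP: yA; rewrite -addsmxE.
    exact: submx_trans (FsA _ Fy) (addsmxSl _ _).
  have := Gq _ Gy; rewrite -subr_le0 qE subr_le0 => /(lt_le_trans yd).
  by rewrite pmulr_lgt0.
exists (G `&` [set x | dot x q = e]); split.
- by rewrite GE; apply: face_face => // v /conv_mem/PG.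
- move=> x Fx; split; first exact: FG.
  by apply/eqP; rewrite -subr_eq0 qE Fd // Fh // mulr0 subr0.
- by move=> x [].
- apply/eqP => HF; have : F v0.
    rewrite -HF; split=> //; apply/eqP; rewrite -subr_eq0 qE /t.
    by rewrite divfK ?subrr // gt_eqF.
  by move=> /Fh hv; rewrite hv ltxx in hv0.
- apply/eqP => HG; have [_ /eqP] : (G `&` [set x | dot x q = e]) z by rewrite HG.
  by rewrite -subr_eq0 qE zd sub0r oppr_eq0 mulf_eq0 !gt_eqF ?hgt.
Qed.

Fact top_face_subproof (P : polytope) : (P : set _) \in faces P.
Proof.
apply/facesP; exists 0, 0; split=> [x _|]; first by rewrite /dot mulmx0 mxE.
by apply/seteqP; split=> [x Px|x []//]; split=> //=; rewrite /dot mulmx0 mxE.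
Qed.
Definition top_face (P : polytope) : face P := FSetSub (top_face_subproof P).

(* The interval [F, P] of the face lattice of P. *)
Definition face_itv (P : polytope) (F : face P) : finType :=
  {G : face P | fle F G && fle G (top_face P)}.

Lemma fle_top (P : polytope) (F : face P) : fle F (top_face P).
Proof. by apply/asboolP; have /facesP[c [b [_ ->]]] := valP F; move=> x []. Qed.

Lemma fle_refl (P : polytope) : reflexive (@fle P).
Proof. by move=> F; apply/asboolP. Qed.

Definition face_itv_bot (P : polytope) (F : face P) : face_itv F :=
  Sub F (introT andP (conj (fle_refl F) (fle_top F))).
Definition face_itv_top (P : polytope) (F : face P) : face_itv F :=
  Sub (top_face P) (introT andP (conj (fle_top F) (fle_refl (top_face P)))).

Lemma face_itv_graded (P : polytope) (F : nonempty_face P) :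
  graded_poset (fun G H : face_itv (val F) => fle (val G) (val H))
    (face_itv_bot (val F)) (face_itv_top (val F))
    (fun G => affdim (val (val G)) - affdim (val (val F)))%N.
Proof.
have F0 : val (val F) !=set0 by apply/set0P; exact: (valP F).
have FG (G : face_itv (val F)) : val (val F) `<=` val (val G).
  by have /andP[/asboolP] := valP G.
have fP (G : face P) : is_face P (val G) by apply/facesP; exact: valP.
split.
- by move=> G; exact: fle_refl.
- move=> G H /andP[/asboolP GH /asboolP HG].
  by apply/val_inj/val_inj/seteqP.
- by move=> G H K /asboolP GH /asboolP HK; apply/asboolP => x /GH/HK.
- by move=> G; apply/asboolP; exact: FG.
- by move=> G; exact: fle_top.
- exact: subnn.
move=> G H /and3P[/asboolP GH nGH /forallP noK].
have G0 := subset_nonempty (FG G) F0.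
rewrite -subSn ?affdimS //; congr subn; apply/eqP.
have nGH' : val (val G) != val (val H) by apply: contra_neq nGH => /val_inj/val_inj.
rewrite eqn_leq andbC (face_dim_lt (fP (val G)) (fP (val H))) //=.
rewrite leqNgt; apply/negP => lt.
have [s _ sE] := polytopeP P.
have := fP (val G); have := fP (val H); rewrite {1 2}sE => fH fG.
have [K [+ GK KH nKG nKH]] := face_between fG fH G0 GH lt.
rewrite -sE => /facesP fK; pose K' : face P := FSetSub fK.
have iK : fle (val F) K' && fle K' (top_face P).
  by rewrite fle_top andbT; apply/asboolP => x /FG/GK.
have GK' : fle (val G) K' by exact/asboolP.
have KH' : fle K' (val H) by exact/asboolP.
have /implyP/(_ (introT andP (conj GK' KH')))/orP := noK (Sub K' iK).
by case=> /eqP K'E; [case/eqP: nKG | case/eqP: nKH]; rewrite -K'E.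
Qed.

Definition face_poset (P : polytope) (F : nonempty_face P) : gposet :=
  gposet_of (face_itv_graded F).

(* Combinatorial equivalence: isomorphism of face lattices. *)
Definition ceq (P Q : polytope) : Prop :=
  exists2 f : face P -> face Q, bijective f & forall F G, fle (f F) (f G) = fle F G.

Fact ceq_equiv : equiv_class_of (fun P Q => `[< ceq P Q >]).
Proof.
split.
- by move=> P; apply/asboolP; exists id => //; exists id.
- suff sym P Q : ceq P Q -> ceq Q P.
    by move=> P Q; apply/asboolP/asboolP; exact: sym.
  move=> [f [g fg gf] h]; exists g; first by exists f.
  by move=> x y; rewrite -h !gf.
- move=> Q P S /asboolP[f bf hf] /asboolP[g bg hg]; apply/asboolP.
  exists (g \o f); first exact: bij_comp.
  by move=> x y; rewrite /= hg hf.
Qed.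
Canonical ceq_equivRel := EquivRelPack ceq_equiv.

(* Combinatorial polytopes.  Values on a class are computed on the
   representative chosen by [repr]; the constructions below depend on the
   class only. *)
Definition cpoly : Type := {eq_quot ceq_equivRel}.
HB.instance Definition _ := Choice.on cpoly.
Definition cpoly_of (P : polytope) : cpoly := \pi_{eq_quot ceq_equivRel} P.
Definition cpoly_repr (c : cpoly) : polytope := repr (c : {eq_quot ceq_equivRel}).

(* The ring of polytopes, as an additive group. *)
Definition polyring : Type := {freeg cpoly / int}.
HB.instance Definition _ := GRing.Zmodule.on polyring.

Definition polyring_Delta_rep (P : polytope) : tensor polyring rota :=
  \sum_(F : nonempty_face P)
    pure (<< cpoly_of (face_polytope F) >> : polyring)
         (<< gclass_of (face_poset F) >> : rota).

Definition polyring_Delta : {additive polyring -> tensor polyring rota} :=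
  zlift (fun c => polyring_Delta_rep (cpoly_repr c)).

(* The flag number f_(a_1, ..., a_k). *)
Definition flag_num (P : polytope) (a : seq nat) : nat :=
  #|[set c : (size a).-tuple (nonempty_face P) |
      sorted (fun F G => fle (val F) (val G)) c &&
      ([seq affdim (val (val F)) | F : nonempty_face P <- c] == a)]|.

(* For a = (a_1, ..., a_k), the list (n - a_k, a_k - a_(k-1), ..., a_2 - a_1). *)
Definition flag_comp (n : nat) (a : seq nat) : seq nat :=
  rev (pairmap (fun x y => y - x)%N (head 0%N a) (rcons (behead a) n)).

Definition fpoly_rep (P : polytope) : qsymA :=
  let n := affdim P in
  alphaM n [::] +
  \sum_(1 <= k < n.+1)
    \sum_(a : k.-tuple 'I_n | sorted ltn (map val a))
      alphaM (head 0%N (map val a)) (flag_comp n (map val a))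
        *+ flag_num P (map val a).

Definition fpoly : {additive polyring -> qsymA} :=
  zlift (fun c => fpoly_rep (cpoly_repr c)).

Definition fstar : {additive polyring -> qsymA} := star \o fpoly.

End Polytopes.

(* Main.v *)
(* Write [gaps c] for the sequence of successive dimension differences along a
   chain c of faces.  Prepending P to the flags of proper faces gives
     f^*(P) = sum of alpha^(dim G_0) M_(gaps c)
   over the chains c : G_0 < ... < G_m = P of non-empty faces, and F([G, P]) is
   the sum of the M_(gaps c) over the chains from G to P.  Deconcatenating
   M_(gaps c) amounts to cutting c at one of its members, a face G_i = F: the
   lower part is a chain of the polytope F, counted by f^*(F), and the upper part
   is a chain from F to P, counted by F([F, P]).  Independence of the chosen
   representatives holds because a rank function is determined by its order. *)
Require Import Defs.
From HB Require Import structures.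
From mathcomp Require Import all_boot all_order all_algebra.
From mathcomp Require Import finmap.
From mathcomp Require Import freeg.
From mathcomp Require Import all_classical reals.
Import Order.TTheory GRing.Theory Num.Theory.
Set Implicit Arguments.
Unset Strict Implicit.
Unset Printing Implicit Defensive.
Local Open Scope ring_scope.

(** * Additive maps on free abelian groups, and sums over tuples *)

Lemma freeg_additive_ext (K : choiceType) (V : zmodType)
    (f g : {additive {freeg K / int} -> V}) :
  (forall x, f << x >> = g << x >>) -> f =1 g.
Proof.
move=> fg D; rewrite -[D]freeg_sumE !raddf_sum; apply: eq_bigr => x _.
have -> : << coeff x D *g x >> = << x >> *~ coeff x D.
  by rewrite freegU_mulz intz.
by rewrite !raddfMz fg.
Qed.

Section TupleSums.
Variables (T : finType) (V : zmodType).

Lemma sum_tuple0 (P : pred (seq T)) (g : seq T -> V) :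
  \sum_(c : 0.-tuple T | P c) g c = if P [::] then g [::] else 0.
Proof.
rewrite big_mkcond (big_pred1 [tuple]) // => c.
by rewrite [c]tuple0 /= eqxx.
Qed.

Lemma sum_tupleS k (P : pred (seq T)) (g : seq T -> V) :
  \sum_(c : k.+1.-tuple T | P c) g c =
  \sum_z \sum_(c : k.-tuple T | P (z :: c)) g (z :: c).
Proof.
rewrite pair_big_dep /= (reindex (fun p : T * k.-tuple T => [tuple of p.1 :: p.2])) //=.
exists (fun c : k.+1.-tuple T => (thead c, [tuple of behead c])).
  by move=> [z c] _; rewrite theadE; congr pair; apply/val_inj.
by move=> c _; rewrite /= [c in RHS]tuple_eta; apply/val_inj.
Qed.

(** Splits off the last entry, which in [star_fpoly_rep] is the top face. *)
Lemma sum_tuple_rcons k (P : pred (seq T)) (g : seq T -> V) :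
  \sum_(c : k.+1.-tuple T | P c) g c =
  \sum_z \sum_(c : k.-tuple T | P (rcons c z)) g (rcons c z).
Proof.
elim: k P g => [|k IH] P g.
  rewrite sum_tupleS; apply: eq_bigr => z _.
  by rewrite (sum_tuple0 (fun c => P (z :: c)) (fun c => g (z :: c)))
             (sum_tuple0 (fun c => P (rcons c z)) (fun c => g (rcons c z))).
rewrite sum_tupleS.
under eq_bigr => x _ do
  rewrite (IH (fun c => P (x :: c)) (fun c => g (x :: c))).
rewrite exchange_big; apply: eq_bigr => z _.
by rewrite (sum_tupleS _ (fun c => P (rcons c z)) (fun c => g (rcons c z))).
Qed.
End TupleSums.

(** * Sums over chains, by recursion on a bound for their length *)

Section ChainSum.
Variables (T : finType) (lt : rel T).

(* The sum of g [:: x_1; ...; x_k] over the chains x < x_1 < ... < x_k, k < N. *)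
Fixpoint chain_sum (V : zmodType) N x (g : seq T -> V) : V :=
  if N is n.+1 then g [::] + \sum_(z | lt x z) chain_sum n z (fun c => g (z :: c))
  else 0.

Lemma chain_sum_tuple (V : zmodType) N x (g : seq T -> V) :
  chain_sum N x g = \sum_(k < N) \sum_(c : k.-tuple T | path lt x c) g c.
Proof.
elim: N x g => [|N IH] x g /=; first by rewrite big_ord0.
rewrite big_ord_recl (sum_tuple0 (path lt x)) /=; congr (_ + _).
under eq_bigr do rewrite IH.
rewrite exchange_big; apply: eq_bigr => k _.
rewrite (sum_tupleS _ (path lt x)) big_mkcond /=; apply: eq_bigr => z _.
by case: ifP => xz //=; rewrite big_pred0.
Qed.

Lemma eq_chain_sum (V : zmodType) N x (g h : seq T -> V) :
  (forall c, path lt x c -> g c = h c) -> chain_sum N x g = chain_sum N x h.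
Proof.
move=> gh; rewrite !chain_sum_tuple; apply: eq_bigr => k _.
by apply: eq_bigr => c /gh.
Qed.

Lemma chain_sum0 (V : zmodType) N x : chain_sum N x (fun=> 0 : V) = 0.
Proof. by rewrite chain_sum_tuple big1 // => k _; rewrite big1. Qed.

Lemma raddf_chain_sum (V W : zmodType) (f : V -> W) N x (g : seq T -> V) :
  f 0 = 0 -> {morph f : u v / u + v} ->
  f (chain_sum N x g) = chain_sum N x (fun c => f (g c)).
Proof.
move=> f0 fD; rewrite !chain_sum_tuple (big_morph f fD f0).
by apply: eq_bigr => k _; rewrite (big_morph f fD f0).
Qed.

Lemma exchange_chain_sum (V : zmodType) (I : finType) N x (g : I -> seq T -> V) :
  \sum_i chain_sum N x (g i) = chain_sum N x (fun c => \sum_i g i c).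
Proof.
rewrite chain_sum_tuple; under eq_bigr do rewrite chain_sum_tuple.
by rewrite exchange_big; apply: eq_bigr => k _; rewrite exchange_big.
Qed.

(** The measure [mu] drops along [lt], so a chain above [x] has at most [mu x] entries and a bound
    exceeding [mu x] truncates nothing. *)
Lemma chain_sum_widen (V : zmodType) (mu : T -> nat) N N' x (g : seq T -> V) :
  (forall y z, lt y z -> mu z < mu y)%N -> (mu x < N)%N -> (mu x < N')%N ->
  chain_sum N x g = chain_sum N' x g.
Proof.
move=> mult; elim: N N' x g => [|N IH] [|N'] x g //= xN xN'.
congr (_ + _); apply: eq_bigr => z /mult zx.
by apply: IH; exact: leq_trans zx _.
Qed.

Lemma chain_sum_widen_card (V : zmodType) N x (g : seq T -> V) :
  transitive lt -> irreflexive lt -> (#|T| <= N)%N ->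
  chain_sum N x g = chain_sum #|T| x g.
Proof.
(* The measure counts the elements above [y]; it stays below [#|T|] because [y] itself is not
   counted. *)
move=> lt_trans lt_irr TN; pose mu y := #|[pred z | lt y z]|.
have muT y : (mu y < #|T|)%N.
  apply/proper_card/properP; split; first exact/subset_predT.
  by exists y; rewrite ?inE ?lt_irr.
apply: (@chain_sum_widen _ mu); [|exact: leq_trans TN|exact: muT].
move=> y z yz; apply/proper_card/properP; split.
  by apply/fintype.subsetP => u; rewrite !inE; exact: lt_trans.
by exists z; rewrite !inE ?lt_irr.
Qed.

(** A chain with a marked cut is the same as a chain [c] from [x] followed by a chain from the last
    member of [c]. *)
Lemma chain_sum_split (V : zmodType) (mu : T -> nat) N x (g : seq T -> seq T -> V) :
  (forall y z, lt y z -> mu z < mu y)%N -> (mu x < N)%N ->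
  chain_sum N x (fun c => \sum_(i < (size c).+1) g (take i c) (drop i c)) =
  chain_sum N x (fun c => chain_sum N (last x c) (g c)).
Proof.
move=> mulr.
(* The inner bound [M] stays fixed while the induction lowers the outer bound [N]. *)
suff gen M : (mu x < N)%N -> (mu x < M)%N ->
    chain_sum N x (fun c => \sum_(i < (size c).+1) g (take i c) (drop i c)) =
    chain_sum N x (fun c => chain_sum M (last x c) (g c)) by move=> xN; exact: gen.
elim: N x g => [|N IH] x g //= xN xM; rewrite big_ord_recl big_ord0 addr0.
(* The cut at 0 leaves all of [z :: c] on the right; the other cuts are cuts of [c], covered by the
   induction hypothesis. *)
have E z : lt x z ->
    chain_sum N z (fun c => \sum_(i < (size c).+2) g (take i (z :: c)) (drop i (z :: c))) =
    chain_sum N z (fun c => g [::] (z :: c)) +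
    chain_sum N z (fun c => chain_sum M (last z c) (g (z :: c))).
  move=> /mulr zx; rewrite -(IH z (fun c => g (z :: c))) ?(leq_trans zx) //; last exact: ltnW.
  rewrite !chain_sum_tuple -big_split; apply: eq_bigr => k _ /=.
  rewrite -big_split; apply: eq_bigr => c _.
  by rewrite big_ord_recl.
rewrite (eq_bigr _ E) big_split addrA; congr (_ + _).
(* The cuts at 0 add up to the inner sum at [x], with bound [N.+1] in place of [M]. *)
by rewrite (chain_sum_widen (mu := mu) (N' := N.+1)).
Qed.
End ChainSum.

(** * Transport of chain sums and rank functions along embeddings *)

Lemma sum_codom (T T' : finType) (V : zmodType) (phi : T -> T') (P : pred T') (g : T' -> V) :
  injective phi -> (forall z, P z -> z \notin codom phi -> g z = 0) ->
  \sum_(z | P z) g z = \sum_(x | P (phi x)) g (phi x).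
Proof.
move=> phi_inj g0; rewrite (bigID [in codom phi]) /= [X in _ + X]big1 ?addr0.
  under eq_bigl => z do rewrite andbC.
  rewrite big_mkcondr -big_uniq; last exact/(injectiveP phi).
  by rewrite /codom /image_mem big_map big_enum -big_mkcondr.
by move=> z /andP[Pz]; exact: g0.
Qed.

(** Chains that leave the image of [phi] must have value 0. In the applications the image consists
    of the faces above a face F, or of those contained in F. *)
Lemma chain_sum_transport (T T' : finType) (lt : rel T) (lt' : rel T') (V : zmodType)
    (phi : T -> T') N x (g : seq T' -> V) :
  injective phi -> (forall y z, lt' (phi y) (phi z) = lt y z) ->
  (forall c, path lt' (phi x) c -> g c != 0 -> {subset c <= codom phi}) ->
  chain_sum lt' N (phi x) g = chain_sum lt N x (fun c => g (map phi c)).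
Proof.
move=> phi_inj ltE; elim: N x g => [|N IH] x g //= gphi; congr (_ + _).
rewrite (sum_codom phi_inj) => [|z xz nz].
  apply: eq_big => [z|z]; rewrite ltE // => xz.
  apply: IH => c zc /gphi; rewrite /= ltE xz zc => /(_ isT) h y yc.
  by apply: h; rewrite inE yc orbT.
rewrite -(chain_sum0 lt' V N z); apply: eq_chain_sum => c zc.
apply/eqP; apply: contraNT nz => /gphi; rewrite /= xz zc => /(_ isT).
by apply; exact: mem_head.
Qed.

(** The two clauses make [d x] the greatest number of steps in a chain ending at [x]; hence [lt]
    determines [d]. *)
Definition is_rank (T : finType) (lt : rel T) (d : T -> nat) : Prop :=
  (forall x y, lt x y -> d x < d y)%N /\
  (forall y m, d y = m.+1 -> exists2 x, lt x y & d x = m).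

(** Each inequality descends by unit steps. A step below [phi x] comes from a step below [x] because
    the image is a down-set; a step below [x] is carried over by [phi]. *)
Lemma is_rank_transport (T T' : finType) (lt : rel T) (lt' : rel T') d d' (phi : T -> T') :
  is_rank lt d -> is_rank lt' d' -> (forall y z, lt' (phi y) (phi z) = lt y z) ->
  (forall x y, lt' y (phi x) -> y \in codom phi) ->
  forall x, d' (phi x) = d x.
Proof.
move=> [dlt dS] [dlt' dS'] ltE down x; apply/eqP; rewrite eqn_leq; apply/andP; split.
  move: {-1}(d' (phi x)) (erefl (d' (phi x))) => m.
  elim: m x => [|m IH] x // /dS'[y yx yE].
  have /codomP[z zE] := down _ _ yx; move: yx yE; rewrite {}zE ltE => zx zE.
  exact: leq_ltn_trans (IH _ zE) (dlt _ _ zx).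
move: {-1}(d x) (erefl (d x)) => m.
elim: m x => [|m IH] x // /dS[y yx yE].
by apply: leq_ltn_trans (IH _ yE) (dlt' _ _ _); rewrite ltE.
Qed.

Arguments chain_sum : simpl never.

(** * Lists of differences, basis elements and flag counts *)

Lemma pairmap_map (A B C : Type) (d : A -> B) (f : B -> B -> C) x s :
  pairmap f (d x) (map d s) = pairmap (fun u v => f (d u) (d v)) x s.
Proof. by elim: s x => //= y s IH x; rewrite IH. Qed.

Lemma take_pairmap (A B : Type) (f : A -> A -> B) x s i :
  take i (pairmap f x s) = pairmap f x (take i s).
Proof. by elim: s x i => [|y s IH] x [|i] //=; rewrite IH. Qed.

Lemma drop_pairmap (A B : Type) (f : A -> A -> B) x s i :
  drop i (pairmap f x s) = pairmap f (last x (take i s)) (drop i s).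
Proof. by elim: s x i => [|y s IH] x [|i] //=; rewrite IH. Qed.

(** Positivity keeps [comp_of] away from its default value, so that [star] and [qsymA_Delta] can be
    evaluated on basis elements. *)
Lemma all_gt0_gaps m s :
  path ltn m s -> all (leq 1) (pairmap (fun x y => y - x)%N m s).
Proof. by elim: s m => //= y s IH m /andP[my /IH ->]; rewrite subn_gt0 my. Qed.

Lemma star_alphaM a w : all (leq 1) w -> star (alphaM a w) = alphaM a (rev w).
Proof. by move=> w1; exact: (qsymA_liftE _ _ (Sub w w1 : composition)). Qed.

Lemma qsymA_Delta_alphaM a w : all (leq 1) w ->
  qsymA_Delta (alphaM a w) =
  \sum_(i < (size w).+1) pure (alphaM a (take i w)) (M (drop i w)).
Proof. by move=> w1; exact: (qsymA_liftE _ _ (Sub w w1 : composition)). Qed.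

(** Replaces a sum weighted by flag numbers by a sum over the flags: an admissible [c] is counted
    for exactly one [a], its own list of dimensions. *)
Lemma sum_card_dims (T : finType) (V : zmodType) (d : T -> nat) n k
    (S : pred (seq T)) (g : seq nat -> V) :
  \sum_(a : k.-tuple 'I_n | sorted ltn (map val a))
    g (map val a) *+ #|[set c : k.-tuple T | S c && (map d c == map val a)]| =
  \sum_(c : k.-tuple T | [&& S c, sorted ltn (map d c) & all (ltn^~ n) (map d c)])
    g (map d c).
Proof.
under eq_bigr do rewrite -sumr_const big_mkcond.
rewrite exchange_big [RHS]big_mkcond; apply: eq_bigr => c _ /=.
under eq_bigr do rewrite inE.
case: ifP => [/and3P[Sc dc cn]|ncond]; last first.
  rewrite big1 // => a sa; case: ifP => // /andP[Sc /eqP dc].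
  rewrite -dc in sa; rewrite Sc sa dc /= in ncond; case/negP: ncond.
  by apply/allP => _ /mapP[i _ ->]; exact: ltn_ord.
have [a aE] : exists a : k.-tuple 'I_n, map val a = map d c.
  have [s sE] : exists s : seq 'I_n, map val s = map d c.
    elim: (map d c) cn => [|i s IH] /=; first by exists [::].
    by case/andP=> i_n /IH[s' <-]; exists (Ordinal i_n :: s').
  have sk : size s == k by rewrite -(size_map val) sE size_map size_tuple.
  by exists (Tuple sk).
rewrite (bigD1 a) ?aE //= Sc eqxx big1 ?addr0 // => b /andP[_ ba].
rewrite -aE; case: ifP => // /eqP /(inj_map val_inj) /val_inj ab.
by rewrite ab eqxx in ba.
Qed.

(** * Ranks in finite graded posets *)

Definition glt (P : gposet) : rel 'I_(gcard P) := fun x y => gle x y && (x != y).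

Lemma glt_irr P : irreflexive (@glt P).
Proof. by move=> x; rewrite /glt eqxx andbF. Qed.

Lemma glt_trans P : transitive (@glt P).
Proof.
case: (gposetP P) => _ anti tr _ _ _ _ y x z /andP[xy nxy] /andP[yz _].
rewrite /glt (tr _ _ _ xy yz); apply: contraNneq nxy => xz.
by apply/eqP/anti; rewrite xy xz yz.
Qed.

Lemma grank_is_rank P : is_rank (@glt P) (@grank P).
Proof.
case: (gposetP P) => refl anti tr bot top rho0 rhoS.
(* Covers only are controlled by [gp_rhoS]. Induction on the number of elements strictly between [x]
   and [y]: without a cover, some [z] splits the interval into two smaller ones. *)
have rhoL (x y : 'I_(gcard P)) : glt x y -> (grank x < grank y)%N.
  pose itv (x y : 'I_(gcard P)) := [pred z | glt x z && glt z y].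
  move: {2}(#|itv x y|) (leqnn #|itv x y|) => m.
  elim: m x y => [|m IH] x y xym xy; have /andP[lexy nxy] := xy.
    rewrite (rhoS x y) //; apply/and3P; split=> //; apply/forallP => z.
    apply/implyP => /andP[xz zy]; apply: contraLR xym; rewrite negb_or => /andP[zx nzy].
    by rewrite -ltnNge; apply/card_gt0P; exists z; rewrite inE /glt xz zy eq_sym zx.
  have [cxy|] := boolP (covers (@gle P) x y); first by rewrite (rhoS x y).
  rewrite /covers lexy nxy /= negb_forall => /existsP[z].
  rewrite negb_imply negb_or => /andP[/andP[xz zy] /andP[zx nzy]].
  have lxz : glt x z by rewrite /glt xz eq_sym.
  have lzy : glt z y by rewrite /glt zy.
  have zitv : z \in itv x y by rewrite inE lxz.
  apply: (@leq_trans (grank z).+1); rewrite ?ltnS; last apply: IH => //.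
    apply: ltnW; apply: IH => //; rewrite -ltnS; apply: leq_trans xym.
    apply/proper_card/properP; split; last by exists z; rewrite ?inE ?glt_irr ?andbF.
    apply/fintype.subsetP => u; rewrite !inE => /andP[-> uz]; exact: glt_trans lzy.
  rewrite -ltnS; apply: leq_trans xym.
  apply/proper_card/properP; split; last by exists z; rewrite ?inE ?glt_irr.
  by apply/fintype.subsetP => u; rewrite !inE => /andP[zu ->]; rewrite (glt_trans lxz).
split=> // y m ym.
have by_ : glt (gbot P) y.
  by rewrite /glt bot /=; apply: contra_eq_neq ym => <-; rewrite rho0.
(* An element of largest rank below [y] is covered by [y], since anything strictly between would
   have larger rank. *)
case: (@arg_maxnP _ _ (@glt P ^~ y) (@grank P) by_) => x xy xmax; exists x => //.
have /andP[lexy nxy] := xy.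
suff : covers (@gle P) x y by move=> /rhoS yx; apply: succn_inj; rewrite -yx ym.
apply/and3P; split=> //; apply/forallP => z; apply/implyP => /andP[xz zy].
apply: contraT; rewrite negb_or => /andP[zx nzy].
have /xmax : glt z y by rewrite /glt zy.
by rewrite /= leqNgt rhoL // /glt xz eq_sym.
Qed.

(** * Non-empty faces, their dimensions, and faces of faces *)

Section Faces.
Variable R : realType.
Local Open Scope classical_set_scope.

Definition nlt (P : polytope R) : rel (nonempty_face P) :=
  fun F G => fle (val F) (val G) && (F != G).

Definition ndim (P : polytope R) (F : nonempty_face P) : nat := affdim (val (val F)).

Lemma nfle_anti (P : polytope R) (F G : nonempty_face P) :
  fle (val F) (val G) -> fle (val G) (val F) -> F = G.
Proof. by move=> /asboolP FG /asboolP GF; apply/val_inj/val_inj/seteqP. Qed.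

Lemma fle_trans (P : polytope R) : transitive (@fle R P).
Proof. by move=> G F H /asboolP FG /asboolP GH; apply/asboolP => x /FG/GH. Qed.

Lemma nlt_trans (P : polytope R) : transitive (@nlt P).
Proof.
move=> G F H /andP[FG nFG] /andP[GH _]; rewrite /nlt (fle_trans FG GH).
by apply: contraNneq nFG => FH; apply/eqP/nfle_anti; rewrite // FH.
Qed.

Lemma nfaceP (P : polytope R) (F : nonempty_face P) : is_face P (val (val F)).
Proof. by apply/facesP; exact: valP. Qed.

Lemma nface_neq0 (P : polytope R) (F : nonempty_face P) : val (val F) !=set0.
Proof. by apply/set0P; exact: (valP F). Qed.

Lemma nface_of (P : polytope R) (S : set 'rV[R]_(pamb P)) :
  is_face P S -> S !=set0 -> exists F : nonempty_face P, val (val F) = S.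
Proof.
move=> /facesP fS /set0P S0.
by exists (Sub (FSetSub fS : face P) S0).
Qed.

Lemma nlt_ndim (P : polytope R) (F G : nonempty_face P) :
  nlt F G -> (ndim F < ndim G)%N.
Proof.
move=> /andP[/asboolP FG nFG].
apply: (face_dim_lt (nfaceP F) (nfaceP G) (nface_neq0 F) FG).
by apply: contra_neq nFG => /val_inj/val_inj.
Qed.

(** Some coordinate is not constant on [G]; the points of [G] where it is largest form a non-empty
    proper face. *)
Lemma positive_dim_face n (s : seq 'rV[R]_n) G :
  is_face (conv s) G -> G !=set0 -> (0 < affdim G)%N ->
  exists H, [/\ is_face (conv s) H, H !=set0, H `<=` G & H != G].
Proof.
move=> [c [b [sb GE]]] G0 dG.
have [x0 [A [Gx0 GA fA _]]] := affdim_basis G0.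
have : A != 0 by apply: contraTneq fA => ->; rewrite /row_free mxrank0 neq_ltn dG.
case/matrix0Pn=> i [j Aij].
(* The functional [q] reads off coordinate [j], in which [x0] and [x0 + row i A] differ by
   [A i j]. *)
pose q : 'cV[R]_n := delta_mx j 0.
have dotq (x : 'rV[R]_n) : dot x q = x 0 j by rewrite /dot /q -colE mxE.
pose s' := [seq v <- s | dot v c == b].
have sG : G = conv s' by rewrite GE conv_face // => v /conv_mem/sb.
have s'0 : s' != [::] by apply: contraPneq Gx0 => s'0; rewrite sG s'0; exact: conv_nil.
have [v0 v0s' v0max] := seq_max (fun v => dot v q) s'0.
exists (conv s `&` [set x | dot x c = b] `&` [set x | dot x q = dot v0 q]); split.
- apply: face_face => v; first by move=> /conv_mem/sb.
  by move=> vs vb; apply: v0max; rewrite mem_filter vb eqxx.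
- exists v0; rewrite -GE sG; split=> //; exact: conv_mem.
- by rewrite -GE => x [].
- rewrite -GE; apply/eqP => HG.
  have Hq x : G x -> dot x q = dot v0 q by rewrite -{1}HG => -[].
  have := Hq _ (GA i); rewrite dotD Hq // !dotq mxE => /eqP.
  by rewrite -subr_eq0 addrAC subrr add0r (negPf Aij).
Qed.

(** By [positive_dim_face] there is a non-empty face properly inside [G]. One of largest dimension
    has dimension [m], as otherwise [face_between] would insert a larger one. *)
Lemma ndim_is_rank (P : polytope R) : is_rank (@nlt P) (@ndim P).
Proof.
split=> [F G|G m Gm]; first exact: nlt_ndim.
have [s _ sE] := polytopeP P.
have fG := nfaceP G; rewrite sE in fG.
have [F0 F0G] : exists F, nlt F G.
  have [|H [fH H0 HG nHG]] := positive_dim_face fG (nface_neq0 G).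
    by rewrite -/(ndim G) Gm.
  rewrite -sE in fH; have [F FE] := nface_of fH H0.
  exists F; apply/andP; split; first by apply/asboolP; rewrite FE.
  by apply: contra_neq nHG => <-.
case: (@arg_maxnP _ _ (@nlt P ^~ G) (@ndim P) F0G) => F FG Fmax; exists F => //; apply/eqP.
rewrite eqn_leq -ltnS -Gm nlt_ndim //= leqNgt; apply/negP => Fm.
have fF := nfaceP F; rewrite sE in fF.
have /andP[/asboolP FG' _] := FG.
have [|H [fH FH HG nHF nHG]] := face_between fF fG (nface_neq0 F) FG'.
  by rewrite -/(ndim G) Gm.
rewrite -sE in fH.
have [K KE] := nface_of fH (subset_nonempty FH (nface_neq0 F)).
have /Fmax : nlt K G.
  apply/andP; split; first by apply/asboolP; rewrite KE.
  by apply: contra_neq nHG => <-; rewrite KE.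
rewrite /= leqNgt nlt_ndim //; apply/andP; split; first by apply/asboolP; rewrite KE.
by apply: contra_neq nHF => ->; rewrite KE.
Qed.

Fact top_nface_subproof (P : polytope R) : val (top_face P) != set0.
Proof.
apply/set0P; have [[|v s] // _ sE] := polytopeP P.
by exists v; rewrite /= sE; apply: conv_mem; exact: mem_head.
Qed.
Definition top_nface (P : polytope R) : nonempty_face P := Sub (top_face P) (top_nface_subproof P).

Lemma ndim_top (P : polytope R) : ndim (top_nface P) = affdim P.
Proof. by []. Qed.

Lemma ndim_le_top (P : polytope R) (F : nonempty_face P) : (ndim F <= affdim P)%N.
Proof.
apply: affdimS; first exact: nface_neq0.
by have /asboolP := fle_top (val F).
Qed.

(** A face of F is a face of P by [face_face]; conversely, the functional that cuts [S] out of P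
    also cuts it out of F. *)
Lemma face_polytope_faceP (P : polytope R) (F : nonempty_face P) S :
  is_face (face_polytope F) S <-> is_face P S /\ S `<=` val (val F).
Proof.
have [s _ sE] := polytopeP P.
have [c [b [Pb FE]]] := nfaceP F.
split=> [[q [e [Fe ->]]]|[[q [e [Pe ->]]] SF]].
  split; last by move=> x [].
  rewrite /= FE sE; apply: face_face => v vs; first by apply: Pb; rewrite sE; exact: conv_mem.
  move=> vb; apply: Fe; rewrite /= FE; split=> //; rewrite sE; exact: conv_mem.
exists q, e; split=> [x|]; first by rewrite /= FE => -[/Pe].
apply/seteqP; split=> [x [Px xe]|x [Fx xe]]; first by split=> //; apply: SF.
by split=> //; move: Fx; rewrite /= FE => -[].
Qed.

(* The empty face is the least element of both lattices, hence matched by f. *)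
Lemma ceq_nonempty_face (P Q : polytope R) : ceq P Q ->
  exists f : nonempty_face P -> nonempty_face Q,
    (forall F G, fle (val (f F)) (val (f G)) = fle (val F) (val G)) /\
    (forall G, G \in codom f).
Proof.
move=> [f [g fK gK] fle_f].
have face0 (S : polytope R) : (set0 : set 'rV[R]_(pamb S)) \in faces S.
  apply/facesP; exists 0, 1; split=> [x _|]; first by rewrite /dot mulmx0 mxE ler01.
  by apply/seteqP; split=> // x [_] /eqP; rewrite /dot mulmx0 mxE eq_sym oner_eq0.
pose bot (S : polytope R) : face S := FSetSub (face0 S).
have bot_le S F : fle (bot S) F by apply/asboolP; exact: sub0set.
have le_bot S F : fle F (bot S) = (val F == set0).
  apply/asboolP/eqP => [FS|->]; last exact: sub0set.
  by apply/seteqP; split=> // x /FS.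
have f0 F : (val (f F) == set0) = (val F == set0).
  rewrite -!le_bot; apply/idP/idP => h.
    by rewrite -fle_f; exact: fle_trans h (bot_le _ _).
  rewrite -[bot Q]gK fle_f; apply: fle_trans h (bot_le _ _).
have fsub (F : nonempty_face P) : val (f (val F)) != set0 by rewrite f0 (valP F).
exists (fun F => Sub (f (val F)) (fsub F)); split=> [F G|G]; first exact: fle_f.
have gG : val (g (val G)) != set0 by rewrite -f0 gK (valP G).
by apply/codomP; exists (Sub (g (val G)) gG); apply/val_inj; rewrite /= gK.
Qed.

(** Meant for [Q] the representative of the class of F: the equivalence is followed by the inclusion
    of the faces of F among those of P. *)
Lemma ceq_face_embed (P Q : polytope R) (F : nonempty_face P) :
  ceq Q (face_polytope F) ->
  exists f : nonempty_face Q -> nonempty_face P,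
    (forall G H, fle (val (f G)) (val (f H)) = fle (val G) (val H)) /\
    (forall G, (G \in codom f) = fle (val G) (val F)).
Proof.
move=> /ceq_nonempty_face[f [fle_f f_surj]].
have isub (G : nonempty_face (face_polytope F)) :
    exists H : nonempty_face P, val (val H) = val (val G).
  by apply: nface_of; [have [] := iffLR (face_polytope_faceP _) (nfaceP G)|exact: nface_neq0 G].
have [i iE] := choice isub.
exists (i \o f); split=> [G H|G].
  by rewrite -fle_f /fle /= !iE.
apply/codomP/asboolP => [[H ->]|GF].
  by rewrite /= iE; have [] := iffLR (face_polytope_faceP _) (nfaceP (f H)).
have [|K KE] := @nface_of (face_polytope F) (val (val G)) _ (nface_neq0 G).
  by apply/face_polytope_faceP; split=> //; exact: nfaceP.
have /codomP[H HE] := f_surj K.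
by exists H; apply/val_inj/val_inj; rewrite /= -HE iE KE.
Qed.

End Faces.

(** * Tensors with a zero factor, and the two invariants as chain sums *)

Lemma pure0l (A B : zmodType) (b : B) : pure (0 : A) b = 0.
Proof. by apply: (addrI (pure 0 b)); rewrite -pureDl !addr0. Qed.

Lemma pure0r (A B : zmodType) (a : A) : pure a (0 : B) = 0.
Proof. by apply: (addrI (pure a 0)); rewrite -pureDr !addr0. Qed.

(** The free bound [N] allows comparison with a chain sum over another poset. *)
Lemma ehrenborg_repE (P : gposet) N : (gcard P <= N)%N ->
  ehrenborg_rep P = chain_sum (@glt P) N (gbot P) (fun c =>
    if last (gbot P) c == gtop P
    then M (pairmap (fun x y => grank y - grank x)%N (gbot P) c) else 0).
Proof.
move=> PN; rewrite chain_sum_widen_card ?card_ord //; [|exact: glt_trans|exact: glt_irr].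
rewrite chain_sum_tuple; apply: eq_bigr => k _.
by rewrite big_mkcondr.
Qed.

Section FaceChains.
Variable R : realType.

Definition gaps (P : polytope R) (F : nonempty_face P) (c : seq (nonempty_face P)) : seq nat :=
  pairmap (fun G H => ndim H - ndim G)%N F c.

Lemma size_gaps (P : polytope R) (F : nonempty_face P) c : size (gaps F c) = size c.
Proof. exact: size_pairmap. Qed.

Lemma gaps_gt0 (P : polytope R) (F : nonempty_face P) c :
  path (@nlt R P) F c -> all (leq 1) (gaps F c).
Proof.
move=> Fc; rewrite /gaps -(pairmap_map (@ndim R P) (fun m n => n - m)%N).
by apply: all_gt0_gaps; exact: homo_path (@nlt_ndim R P) Fc.
Qed.

Lemma path_nlt_last (P : polytope R) (F : nonempty_face P) c :
  path (@nlt R P) F c -> {in F :: c, forall G, fle (val G) (val (last F c))}.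
Proof.
elim: c F => [|H c IH] F /=; first by move=> _ G; rewrite inE => /eqP ->; exact: fle_refl.
move=> /andP[/andP[FH _] Hc] G; rewrite inE => /orP[/eqP ->|]; last exact: IH.
by apply: fle_trans FH (IH _ Hc _ _); exact: mem_head.
Qed.

Lemma codim_nlt (P : polytope R) (F G : nonempty_face P) :
  nlt F G -> (affdim P - ndim G < affdim P - ndim F)%N.
Proof.
by move=> /nlt_ndim FG; rewrite ltn_sub2l // (leq_trans FG) // ndim_le_top.
Qed.

(** The elements of [G] are identified with the faces above [F] by an order embedding [phi], and the
    chain sum is transported along it. *)
Lemma ehrenborg_face (P : polytope R) (F : nonempty_face P) (G : gposet) :
  giso G (face_poset F) ->
  ehrenborg_rep G = chain_sum (@nlt R P) (affdim P).+1 F (fun c =>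
    if last F c == top_nface P then M (gaps F c) else 0).
Proof.
move=> [f bf gle_f].
(* The isomorphism is only known to respect the order; it respects ranks because the order
   determines them. *)
have rank_f x : grank (f x) = grank x.
  apply: (is_rank_transport (grank_is_rank G) (grank_is_rank (face_poset F))).
    by move=> y z; rewrite /glt gle_f (inj_eq (bij_inj bf)).
  by case: bf => g _ gK _ y _; rewrite -[y]gK codom_f.
have isub (i : 'I_(gcard (face_poset F))) :
    exists H : nonempty_face P, val H = val (enum_val i).
  have /andP[FH _] := valP (enum_val i).
  have H0 : val (val (enum_val i)) != set0.
    apply/set0P; apply: subset_nonempty (nface_neq0 F); exact/asboolP.
  by exists (Sub (val (enum_val i)) H0).
have [psi psiE] := choice isub; pose phi x := psi (f x).
have phi_le x y : fle (val (phi x)) (val (phi y)) = gle x y.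
  by rewrite -gle_f /phi !psiE.
have phi_inj : injective phi.
  have [_ anti _ _ _ _ _] := gposetP G.
  by move=> x y xy; apply: anti; rewrite -!phi_le xy fle_refl.
have phi_codom H : (H \in codom phi) = fle (val F) (val H).
  apply/codomP/idP => [[x ->]|FH].
    by rewrite /phi psiE; have /andP[] := valP (enum_val (f x)).
  have iH : fle (val F) (val H) && fle (val H) (top_face P) by rewrite FH fle_top.
  case: bf => g _ gK; exists (g (enum_rank (Sub (val H) iH : face_itv (val F)))).
  by apply/val_inj; rewrite /phi gK psiE enum_rankK.
have [_ _ _ bot top _ _] := gposetP G.
have phi_bot : phi (gbot G) = F.
  apply: nfle_anti; last by rewrite -phi_codom codom_f.
  have /codomP[x ->] : F \in codom phi by rewrite phi_codom fle_refl.
  by rewrite phi_le bot.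
have phi_top : phi (gtop G) = top_nface P.
  apply: nfle_anti; first exact: fle_top.
  have /codomP[x ->] : top_nface P \in codom phi by rewrite phi_codom fle_top.
  by rewrite phi_le top.
(* The offset [ndim F] cancels; with truncated subtraction this needs [Fx]. *)
have phi_rank x y : (ndim (phi y) - ndim (phi x) = grank y - grank x)%N.
  have E z : grank z = (ndim (phi z) - ndim F)%N by rewrite -rank_f /ndim /phi psiE.
  have Fx : (ndim F <= ndim (phi x))%N.
    have : fle (val F) (val (phi x)) by rewrite -phi_codom codom_f.
    by move=> /asboolP; exact: affdimS (nface_neq0 F).
  by rewrite !E -subnDA subnKC.
(* A common bound, large enough for the chains of [G] and for the chains of faces. *)
pose N := (gcard G + (affdim P).+1)%N.
rewrite (@ehrenborg_repE _ N) ?leq_addr //.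
rewrite (@chain_sum_widen _ _ _ (fun H => affdim P - ndim H)%N _ N); last 3 first.
- exact: codim_nlt.
- by rewrite ltnS leq_subr.
- by rewrite /N addnS ltnS (leq_trans (leq_subr _ _)) // leq_addl.
rewrite -{1 2 3}phi_bot -phi_top (chain_sum_transport (lt := @glt G)) //.
- apply: eq_chain_sum => c _; rewrite last_map (inj_eq phi_inj) /gaps pairmap_map.
  congr (if _ then M (pairmap _ _ _) else 0).
  by apply/funext => x; apply/funext => y; rewrite phi_rank.
- by move=> x y; rewrite /nlt /glt phi_le (inj_eq phi_inj).
- move=> c; rewrite phi_bot => Fc _ H Hc; rewrite phi_codom.
  have := order_path_min (@nlt_trans R P) Fc.
  by move=> /allP/(_ H Hc)/andP[].
Qed.

(** Recasts the classical set of [flag_num] as a [finset] of tuples of prescribed length, the form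
    used by [sum_card_dims]. *)
Lemma flag_numE (P : polytope R) k (a : seq nat) : size a = k ->
  flag_num P a = #|[set c : k.-tuple (nonempty_face P) |
      sorted (fun F G => fle (val F) (val G)) c && (map (@ndim R P) c == a)]|.
Proof.
move=> <-; apply: eq_card => c; rewrite finset.inE.
by apply/idP/idP => [/set_mem|h]; last exact: mem_set.
Qed.

(** Nested non-empty faces are distinct exactly when their dimensions differ, and the bound
    [affdim P] excludes the top face, which can therefore be appended. *)
Lemma sorted_nlt_top (P : polytope R) (c : seq (nonempty_face P)) :
  [&& sorted (fun F G : nonempty_face P => fle (val F) (val G)) c,
      sorted ltn (map (@ndim R P) c) & all (ltn^~ (affdim P)) (map (@ndim R P) c)] =
  sorted (@nlt R P) (rcons c (top_nface P)).
Proof.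
case: c => //= F c; rewrite rcons_path.
have nltE : @nlt R P =2 [rel F G | fle (val F) (val G) && (ndim F < ndim G)%N].
  move=> G H; apply/idP/idP => /= [GH|/andP[GH dGH]].
    by rewrite nlt_ndim // andbT; case/andP: GH.
  by rewrite /nlt GH; apply: contraTneq dGH => ->; rewrite ltnn.
have -> : path (@nlt R P) F c =
    path (fun F G : nonempty_face P => fle (val F) (val G)) F c &&
    path ltn (ndim F) (map (@ndim R P) c).
  rewrite (eq_path nltE) path_relI; congr (_ && _).
  by rewrite path_map.
rewrite -andbA; apply/and3P/and3P => -[leFc ltFc] H; split=> //.
  rewrite nltE /= fle_top ndim_top.
  have /allP := H : all (ltn^~ (affdim P)) (map (@ndim R P) (F :: c)).
  by apply; apply: map_f; exact: mem_last.
have Fc : path (@nlt R P) F c.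
  by rewrite (eq_path nltE) path_relI leFc; move: ltFc; rewrite path_map.
rewrite -[_ && _]/(all (ltn^~ (affdim P)) (map (@ndim R P) (F :: c))).
apply/allP => _ /mapP[G Gc ->].
apply: leq_ltn_trans (nlt_ndim H); apply: affdimS (nface_neq0 _) _.
exact/asboolP/path_nlt_last.
Qed.

(** The involution undoes the [rev] in [flag_comp], so a flag of proper faces with P appended
    contributes the gaps of the resulting chain. *)
Lemma star_fpoly_rep (P : polytope R) :
  star (fpoly_rep P) =
  \sum_F chain_sum (@nlt R P) (affdim P).+1 F (fun c =>
    if last F c == top_nface P then alphaM (ndim F) (gaps F c) else 0).
Proof.
pose h (s : seq (nonempty_face P)) : qsymA := if s is F :: c then
  if last F c == top_nface P then alphaM (ndim F) (gaps F c) else 0 else 0.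
set n := affdim P.
have -> : \sum_F chain_sum (@nlt R P) n.+1 F (fun c => h (F :: c)) =
    \sum_(k < n.+1) \sum_(c : k.-tuple _ | sorted (@nlt R P) (rcons c (top_nface P)))
      h (rcons c (top_nface P)).
  under eq_bigr do rewrite chain_sum_tuple.
  rewrite exchange_big; apply: eq_bigr => k _.
  rewrite -(sum_tupleS k (sorted (@nlt R P)) h) sum_tuple_rcons.
  (* Only chains whose last entry is P have a non-zero [h]. *)
  rewrite (bigD1 (top_nface P)) //= [X in _ + X]big1 ?addr0 // => F nF.
  rewrite big1 // => c _; rewrite /h headI /=.
  case: (tval c) => [|G s] /=; first by rewrite (negPf nF).
  by rewrite last_rcons (negPf nF).
(* The term [k = 0] is the chain consisting of P alone; it matches [alphaM n [::]]. *)
rewrite big_ord_recl (sum_tuple0 (fun c => sorted _ (rcons c _))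
  (fun c => h (rcons c (top_nface P)))) /= eqxx.
rewrite /fpoly_rep raddfD /= star_alphaM //; congr (_ + _).
rewrite raddf_sum /= -/n big_add1 /= big_mkord; apply: eq_bigr => k _.
pose X (s : seq nat) : qsymA :=
  alphaM (head 0%N s) (pairmap (fun x y => y - x)%N (head 0%N s) (rcons (behead s) n)).
rewrite raddf_sum /=.
transitivity (\sum_(a : k.+1.-tuple 'I_n | sorted ltn (map val a)) X (map val a) *+
   #|[set c : k.+1.-tuple (nonempty_face P) |
      sorted (fun F G => fle (val F) (val G)) c && (map (@ndim R P) c == map val a)]|).
  apply: eq_bigr => a sa; rewrite raddfMn /= -flag_numE ?size_map ?size_tuple //.
  congr (_ *+ _); rewrite star_alphaM /flag_comp ?revK // all_rev.
  apply: all_gt0_gaps; move: sa; case: a => -[|i s] //= _ si.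
  rewrite rcons_path si /= last_map; exact: ltn_ord.
rewrite sum_card_dims; apply: eq_big => c; first exact: sorted_nlt_top.
case: c => -[|F c] //= _ _; rewrite /h last_rcons eqxx /gaps.
by rewrite -(pairmap_map (@ndim R P) (fun m n => n - m)%N) map_rcons.
Qed.

(** The faces of [Q] embed onto the faces of P inside F. This image is a down-set, so dimensions are
    preserved, and every chain ending at F lies in it. *)
Lemma fstar_face (P Q : polytope R) (F : nonempty_face P) :
  ceq Q (face_polytope F) ->
  star (fpoly_rep Q) =
  \sum_G chain_sum (@nlt R P) (affdim P).+1 G (fun c =>
    if last G c == F then alphaM (ndim G) (gaps G c) else 0).
Proof.
move=> /ceq_face_embed[f [f_le f_codom]].
have f_inj : injective f.
  by move=> G H GH; apply: nfle_anti; rewrite -f_le GH fle_refl.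
have f_lt G H : nlt (f G) (f H) = nlt G H by rewrite /nlt f_le (inj_eq f_inj).
have f_dim G : ndim (f G) = ndim G.
  apply: (is_rank_transport (ndim_is_rank Q) (ndim_is_rank P)) => // x y /andP[yx _].
  by rewrite f_codom (fle_trans yx) // -f_codom codom_f.
have f_top : f (top_nface Q) = F.
  apply: nfle_anti; first by rewrite -f_codom codom_f.
  have /codomP[G ->] : F \in codom f by rewrite f_codom fle_refl.
  by rewrite f_le fle_top.
have dFP : (affdim Q <= affdim P)%N by rewrite -ndim_top -f_dim ndim_le_top.
(* A face outside the image is not contained in F, so no chain from it ends at F. *)
rewrite star_fpoly_rep [RHS](sum_codom f_inj) => [|G _ nG]; last first.
  rewrite -[RHS](chain_sum0 (@nlt R P) qsymA (affdim P).+1 G).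
  apply: eq_chain_sum => c Gc.
  case: eqP => // GF; case/negP: nG; rewrite f_codom -GF.
  by apply: path_nlt_last Gc _ (mem_head _ _).
apply: eq_bigr => G _.
rewrite (@chain_sum_widen _ _ _ (fun H => affdim Q - ndim H)%N _ (affdim P).+1); last 3 first.
- exact: codim_nlt.
- by rewrite ltnS leq_subr.
- by rewrite ltnS (leq_trans (leq_subr _ _)).
rewrite (chain_sum_transport (lt := @nlt R Q)) //.
  apply: eq_chain_sum => c _; rewrite last_map -f_top (inj_eq f_inj) f_dim /gaps pairmap_map.
  congr (if _ then alphaM _ (pairmap _ _ _) else 0).
  by apply/funext => x; apply/funext => y; rewrite !f_dim.
move=> c Gc; have [GF _ H Hc|_] := eqVneq (last (f G) c) F; last by rewrite eqxx.
by rewrite f_codom -GF; apply: path_nlt_last Gc _ _; rewrite inE Hc orbT.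
Qed.

Lemma cpoly_reprK (P : polytope R) : ceq (cpoly_repr (cpoly_of P)) P.
Proof. by apply/asboolP/(eqmodP (@ceq_equivRel R)); rewrite reprK. Qed.

End FaceChains.

(** * Comparison of the two coactions *)

Lemma gclass_reprK (P : gposet) : giso (gclass_repr (gclass_of P)) P.
Proof. by apply/asboolP/(eqmodP giso_equivRel); rewrite reprK. Qed.

Theorem proposition40 (R : realType) :
  (qsymA_Delta \o fstar R : polyring R -> tensor qsymA qsym) =
  tmap (fstar R) ehrenborg \o polyring_Delta R.
Proof.
apply/funext; apply: freeg_additive_ext => C /=.
rewrite /fstar /= !zliftU; set P := cpoly_repr C.
rewrite /polyring_Delta_rep raddf_sum /=.
pose eF (F : nonempty_face P) := chain_sum (@nlt R P) (affdim P).+1 F (fun c =>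
    if last F c == top_nface P then M (gaps F c) else 0).
(* The right-hand side, expanded in its first tensor factor: chains from G to F, each paired with
   the Ehrenborg function [eF F] of [F, P]. *)
transitivity (\sum_(F : nonempty_face P) \sum_(G : nonempty_face P)
    chain_sum (@nlt R P) (affdim P).+1 G (fun c =>
    if last G c == F then pure (alphaM (ndim G) (gaps G c)) (eF F) else 0)); last first.
  apply: eq_bigr => F _; rewrite tmapE /= !zliftU.
  rewrite (fstar_face (cpoly_reprK (face_polytope F))).
  rewrite (ehrenborg_face (gclass_reprK (face_poset F))) -/(eF F).
  pose p : qsymA -> _ := fun x => pure x (eF F).
  have p0 : p 0 = 0 by exact: pure0l.
  have pD : {morph p : u v / u + v} by move=> u v; exact: pureDl.
  rewrite -/(p _) (big_morph p pD p0); apply: eq_bigr => G _.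
  rewrite (raddf_chain_sum _ _ _ _ p0 pD); apply: eq_chain_sum => c _.
  by case: ifP.
rewrite star_fpoly_rep raddf_sum exchange_big; apply: eq_bigr => G _ /=.
rewrite exchange_chain_sum (raddf_chain_sum _ _ _ _ (raddf0 _) (raddfD _)).
(* The contribution of a chain [c] from G continued by [c'], which counts only if it ends at P. *)
pose g (c c' : seq (nonempty_face P)) := if last (last G c) c' == top_nface P
  then pure (alphaM (ndim G) (gaps G c)) (M (gaps (last G c) c')) else 0.
(* Deconcatenation of the gaps of a chain becomes a sum over its cuts. *)
transitivity (chain_sum (@nlt R P) (affdim P).+1 G (fun c =>
    \sum_(i < (size c).+1) g (take i c) (drop i c))).
  apply: eq_chain_sum => c Gc; rewrite /g.
  have lastE i : last (last G (take i c)) (drop i c) = last G c.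
    by rewrite -last_cat cat_take_drop.
  under [RHS]eq_bigr do rewrite lastE.
  case: ifP => _; last by rewrite raddf0 big1.
  rewrite qsymA_Delta_alphaM ?gaps_gt0 // size_gaps.
  by apply: eq_bigr => i _; rewrite /gaps take_pairmap drop_pairmap.
rewrite (chain_sum_split g (@codim_nlt R P)) ?ltnS ?leq_subr //.
apply: eq_chain_sum => c _.
(* Among all F only the end of the lower chain survives: the face at which the chain was cut. *)
rewrite (bigD1 (last G c)) //= eqxx big1 ?addr0 => [|F]; last first.
  by rewrite eq_sym => /negPf ->.
have p0 := pure0r qsym (alphaM (ndim G) (gaps G c)).
have pD := pureDr (B := qsym) (alphaM (ndim G) (gaps G c)).
rewrite (raddf_chain_sum _ _ _ _ p0 pD); apply: eq_chain_sum => c' _.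
by rewrite /g; case: ifP.
Qed.
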